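(* Let $\Gamma$ be a resource context, $A\subseteq \mathbf{Var}$, $P,Q$ assertions and $C$ an unextended command. If the specification $\Gamma\vdash_{A}\{P\}C\{Q\}$ is derivable in Concurrent Separation Logic, then $\Gamma\models\{P\}C\{Q\}$.
   Context: States and assertions. $\mathbf{Var}$ is a set of variables, $\mathbf{Val}$ a set of values containing the integers and a value $null$, $\mathbf{Loc}\subseteq\mathbb{N}$ a set of locations. A store is a function $s:\mathbf{Var}\to\mathbf{Val}$, a heap is a finite partial function $h:\mathbf{Loc}\rightharpoonup\mathbf{Val}$; $\mathcal{S}$ is the set of pairs $(s,h)$. Expressions $e::=x\mid n\mid e_1+e_2\mid e_1-e_2\mid e_1\times e_2$; boolean expressions $B::=\texttt{true}\mid\texttt{false}\mid e_1=e_2\mid e_1<e_2\mid B_1\wedge B_2\mid\neg B$; assertions $P::=B\mid\neg P\mid P_1\wedge P_2\mid\forall x P\mid\texttt{emp}\mid e\mapsto e'_1,\dots,e'_n\mid P_1\ast P_2$, where $e\mapsto e'_1,\dots,e'_n$ abbreviates $e\mapsto e'_1\ast(e+1)\mapsto e'_2\ast\dots\ast(e+n-1)\mapsto e'_n$. Satisfaction $s,h\models P$ is the standard separation-logic one ($\texttt{emp}$: empty heap; $e\mapsto e'$: heap with exactly the cell $s(e)$ holding $s(e')$; $P_1\ast P_2$: $h=h_1\uplus h_2$ with $s,h_i\models P_i$; pure and classical connectives as usual). $FV$ denotes free variables. $h\bot g$ means disjoint domains and $h\uplus g$ is their union. An assertion $P$ is precise if for every $(s,h)$ there is at most one subheap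 $h'$ of $h$ with $s,h'\models P$. $\mathbf{Res}$ is a set of resource names disjoint from $\mathbf{Var}$. A resource context $\Gamma$ is a list $r_1(X_1):R_1,\dots,r_n(X_n):R_n$ with distinct $r_i\in\mathbf{Res}$, $X_i\subseteq\mathbf{Var}$, $R_i$ precise with $FV(R_i)\subseteq X_i$; $Res(\Gamma)=\{r_1,\dots,r_n\}$, $PV(r_i)=X_i$, $PV(\Gamma)=\bigcup_iX_i$, $\Gamma(r_i)=R_i$, $inv(\Gamma)=R_1\ast\dots\ast R_n$; $\Gamma[r'/r]$ renames $r$ to $r'$. Commands. Basic commands $c::=x:=e\mid x:=[e]\mid[e]:=e'\mid x:=\mathsf{cons}(e_1,\dots,e_n)\mid\mathsf{dispose}(e)$. Unextended commands: $C::=\mathsf{skip}\mid c\mid C_1;C_2\mid\mathsf{if}\ B\ \mathsf{then}\ C_1\ \mathsf{else}\ C_2\mid\mathsf{while}\ B\ \mathsf{do}\ C\mid\mathsf{resource}\ r\ \mathsf{in}\ C\mid\mathsf{with}\ r\ \mathsf{when}\ B\ \mathsf{do}\ C\mid C_1\|C_2$; the extended language additionally has $\mathsf{within}\ r\ \mathsf{do}\ C$. $mod(C)$ is the set of $x$ such that $C$ contains $x:=e$, $x:=[e]$ or $x:=\mathsf{cons}(\dots)$. $Res(C)$ is the set of resource names occurring in $C$; $C[r'/r]$ is renaming of resource $r$ to $r'$. A set $X$ of variables is auxiliary for $C$ if every occurrence in $C$ of a variable of $X$ is inside an assignment $x:=e$ to a variable $x\in X$; $C\setminus X$ replaces every assignment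 to a variable of $X$ by $\mathsf{skip}$. $Locked(C_1;C_2)=Locked(C_1)$, $Locked(C_1\|C_2)=Locked(C_1)\cup Locked(C_2)$, $Locked(\mathsf{resource}\ r\ \mathsf{in}\ C)=Locked(C)\setminus\{r\}$, $Locked(\mathsf{within}\ r\ \mathsf{do}\ C)=Locked(C)\cup\{r\}$, and $Locked(C)=\emptyset$ otherwise. $[c](s,h)$ is the standard result (a pair $(s',h')$, possibly nondeterministically for $\mathsf{cons}$, which allocates $n$ consecutive fresh locations initialised with $e_1,\dots,e_n$ and stores the first in $x$; or $\mathsf{abort}$ when $x:=[e]$, $[e]:=e'$ or $\mathsf{dispose}(e)$ accesses a location outside $dom(h)$). Operational semantics. A resource configuration is a triple $\rho=(O,L,D)$ of pairwise disjoint subsets of $\mathbf{Res}$; $\mathcal{O}$ is the set of these; $r\in\rho$ means $r\in O\cup L\cup D$; $\rho\setminus\{r\}=(O\setminus\{r\},L\setminus\{r\},D\setminus\{r\})$. The program transition relation $\to_p$ from $(C,(s,h,\rho))$ to $(C',(s',h',\rho'))$ or to $\mathsf{abort}$ is the least relation closed under: (S1) $\mathsf{skip};C_2,\sigma\to_p C_2,\sigma$; (S2) if $C_1,\sigma\to_pC_1',\sigma'$ then $C_1;C_2,\sigma\to_pC_1';C_2,\sigma'$; (LP) $\mathsf{while}\ B\ \mathsf{do}\ C,\sigma\to_p\mathsf{if}\ B\ \mathsf{then}\ (C;\mathsf{while}\ B\ \mathsf{do}\ C)\ \mathsf{else}\ \mathsf{skip},\sigma$; (IF1/IF2) $\mathsf{if}\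 B\ \mathsf{then}\ C_1\ \mathsf{else}\ C_2,(s,h,\rho)\to_pC_1$ (resp. $C_2$) with the same state if $s(B)=\texttt{true}$ (resp. $\texttt{false}$); (P1/P2) if $C_1,\sigma\to_pC_1',\sigma'$ then $C_1\|C_2,\sigma\to_pC_1'\|C_2,\sigma'$, symmetrically for $C_2$; (P3) $\mathsf{skip}\|\mathsf{skip},\sigma\to_p\mathsf{skip},\sigma$; (R0) $\mathsf{resource}\ r\ \mathsf{in}\ \mathsf{skip},(s,h,\rho)\to_p\mathsf{skip},(s,h,\rho)$ if $r\notin\rho$; (R1) if $r\notin\rho=(O,L,D)$, $r\in Locked(C)$ and $C,(s,h,(O\cup\{r\},L,D))\to_pC',(s',h',\rho')$ then $\mathsf{resource}\ r\ \mathsf{in}\ C,(s,h,\rho)\to_p\mathsf{resource}\ r\ \mathsf{in}\ C',(s',h',\rho'\setminus\{r\})$; (R2) the same with $r\notin Locked(C)$ and $(O,L,D\cup\{r\})$ in place of $(O\cup\{r\},L,D)$; (W0) $\mathsf{with}\ r\ \mathsf{when}\ B\ \mathsf{do}\ C,(s,h,(O,L,D\cup\{r\}))\to_p\mathsf{within}\ r\ \mathsf{do}\ C,(s,h,(O\cup\{r\},L,D))$ if $s(B)=\texttt{true}$; (W1) if $r\in O$ and $C,(s,h,(O\setminus\{r\},L,D))\to_pC',(s',h',(O',L',D'))$ then $\mathsf{within}\ r\ \mathsf{do}\ C,(s,h,(O,L,D))\to_p\mathsf{within}\ r\ \mathsf{do}\ C',(s',h',(O'\cup\{r\},L',D'))$;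 (W2) $\mathsf{within}\ r\ \mathsf{do}\ \mathsf{skip},(s,h,(O\cup\{r\},L,D))\to_p\mathsf{skip},(s,h,(O,L,D\cup\{r\}))$; (BCT) $c,(s,h,\rho)\to_p\mathsf{skip},(s',h',\rho)$ if $[c](s,h)=(s',h')$. Abort rules: (RA) $\mathsf{resource}\ r\ \mathsf{in}\ C$ aborts if $r\in\rho$; (WA) $\mathsf{with}\ r\ \mathsf{when}\ B\ \mathsf{do}\ C$ aborts if $r\notin\rho$; (RA1) $\mathsf{resource}\ r\ \mathsf{in}\ C,(s,h,(O,L,D))$ aborts if $r\in Locked(C)$ and $C,(s,h,(O\cup\{r\},L,D))\to_p\mathsf{abort}$; (RA2) likewise if $r\notin Locked(C)$ and $C,(s,h,(O,L,D\cup\{r\}))\to_p\mathsf{abort}$; (BCA) $c$ aborts if $[c](s,h)=\mathsf{abort}$; (SA) $C_1;C_2$ aborts if $C_1$ does; (WA1) $\mathsf{within}\ r\ \mathsf{do}\ C,(s,h,\rho)$ aborts if $C,(s,h,\rho\setminus\{r\})\to_p\mathsf{abort}$; (WA2) $\mathsf{within}\ r\ \mathsf{do}\ C,(s,h,(O,L,D))$ aborts if $r\notin O$; (PA1/PA2) $C_1\|C_2$ aborts if $C_1$ or $C_2$ does. $\to_p^k$ is the $k$-fold composition. Validity. $\Gamma\models\{P\}C\{Q\}$ means: for every $(s,h)\in\mathcal{S}$ with $s,h\models P\ast inv(\Gamma)$, (1) $C,(s,h,(\emptyset,\emptyset,Res(\Gamma)))\not\to_p^k\mathsf{abort}$ for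 every $k\ge0$, and (2) whenever $C,(s,h,(\emptyset,\emptyset,Res(\Gamma)))\to_p^k\mathsf{skip},(s',h',(\emptyset,\emptyset,Res(\Gamma)))$ for some $k\ge0$, then $s',h'\models Q\ast inv(\Gamma)$. Proof system. A specification $\Gamma\vdash_A\{P\}C\{Q\}$ ($A\subseteq\mathbf{Var}$, the rely-set) is well-formed if $FV(P,Q)\subseteq A$ and $FV(C)\subseteq A\cup PV(\Gamma)$. Derivable specifications are the well-formed ones generated by the rules: (SKP) $\Gamma\vdash_A\{P\}\mathsf{skip}\{P\}$; (BC) from $\vdash^{SL}\{P\}c\{Q\}$ (derivability in standard sequential separation logic) and $mod(c)\cap PV(\Gamma)=\emptyset$ infer $\Gamma\vdash_A\{P\}c\{Q\}$; (SEQ) from $\Gamma\vdash_{A_1}\{P_1\}C_1\{P_2\}$ and $\Gamma\vdash_{A_2}\{P_2\}C_2\{P_3\}$ infer $\Gamma\vdash_{A_1\cup A_2}\{P_1\}C_1;C_2\{P_3\}$; (FRA) from $\Gamma\vdash_A\{P\}C\{Q\}$ and $mod(C)\cap FV(R)=\emptyset$ infer $\Gamma\vdash_{A\cup FV(R)}\{P\ast R\}C\{Q\ast R\}$; (LP) from $\Gamma\vdash_A\{P\wedge B\}C\{P\}$ infer $\Gamma\vdash_A\{P\}\mathsf{while}\ B\ \mathsf{do}\ C\{P\wedge\neg B\}$; (CONJ) from $\Gamma\vdash_{A_1}\{P_1\}C\{Q_1\}$, $\Gamma\vdash_{A_2}\{P_2\}C\{Q_2\}$ infer $\Gamma\vdash_{A_1\cup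 A_2}\{P_1\wedge P_2\}C\{Q_1\wedge Q_2\}$; (IF) from $\Gamma\vdash_{A_1}\{P\wedge B\}C_1\{Q\}$, $\Gamma\vdash_{A_2}\{P\wedge\neg B\}C_2\{Q\}$ infer $\Gamma\vdash_{A_1\cup A_2}\{P\}\mathsf{if}\ B\ \mathsf{then}\ C_1\ \mathsf{else}\ C_2\{Q\}$; (CONS) from $\Gamma\vdash_A\{P\}C\{Q\}$, $\models P'\Rightarrow P$, $\models Q\Rightarrow Q'$, $A\subseteq A'$ infer $\Gamma\vdash_{A'}\{P'\}C\{Q'\}$; (AUX) from $\Gamma\vdash_{A\cup X}\{P\}C\{Q\}$ with $X\cap FV(P,Q)=\emptyset$, $X\cap PV(\Gamma)=\emptyset$, $X$ auxiliary for $C$, infer $\Gamma\vdash_A\{P\}C\setminus X\{Q\}$; (REN) from $\Gamma[r'/r]\vdash_A\{P\}C[r'/r]\{Q\}$ with $r'\notin Res(C)$, $r'\notin Res(\Gamma)$ infer $\Gamma\vdash_A\{P\}C\{Q\}$; (PAR) from $\Gamma\vdash_{A_1}\{P_1\}C_1\{Q_1\}$, $\Gamma\vdash_{A_2}\{P_2\}C_2\{Q_2\}$ with $mod(C_1)\cap A_2=mod(C_2)\cap A_1=\emptyset$ infer $\Gamma\vdash_{A_1\cup A_2}\{P_1\ast P_2\}C_1\|C_2\{Q_1\ast Q_2\}$; (CR) from $\Gamma\vdash_{A\cup X}\{(P\wedge B)\ast R\}C\{Q\ast R\}$ infer $\Gamma,r(X):R\vdash_A\{P\}\mathsf{with}\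 r\ \mathsf{when}\ B\ \mathsf{do}\ C\{Q\}$; (RES) from $\Gamma,r(X):R\vdash_A\{P\}C\{Q\}$ infer $\Gamma\vdash_{A\cup X}\{P\ast R\}\mathsf{resource}\ r\ \mathsf{in}\ C\{Q\ast R\}$. *)

(* Defs.v *)
From mathcomp Require Import all_boot all_order all_algebra finmap.
From mathcomp Require Import boolp classical_sets.
From Stdlib Require List.

Set Implicit Arguments.
Unset Strict Implicit.
Unset Printing Implicit Defensive.

Local Open Scope classical_set_scope.

(* Values contain the integers and [null].  The operations occurring in
   expressions are those of the integers; on other values they are total but
   left arbitrary. *)
Record valueType := ValueType {
  value :> eqType;
  vint : int -> value;
  vnull : value;
  vadd : value -> value -> value;
  vsub : value -> value -> value;
  vmul : value -> value -> value;
  vlt : rel value;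
  vint_inj : injective vint;
  vnull_not_int : forall n, vnull <> vint n;
  vadd_int : forall m n, vadd (vint m) (vint n) = vint (m + n)%R;
  vsub_int : forall m n, vsub (vint m) (vint n) = vint (m - n)%R;
  vmul_int : forall m n, vmul (vint m) (vint n) = vint (m * n)%R;
  vlt_int : forall m n, vlt (vint m) (vint n) = (m < n)%R
}.

Section Expressions.
Context {Var : eqType}.

Inductive exp :=
| EVar of Var
| EInt of int
| EAdd of exp & exp
| ESub of exp & exp
| EMul of exp & exp.

Inductive bexp :=
| BTrue
| BFalse
| BEq of exp & exp
| BLt of exp & exp
| BAnd of bexp & bexp
| BNot of bexp.

Inductive assn :=
| ABool of bexp
| ANot of assn
| AAnd of assn & assn
| AForall of Var & assn
| AEmp
| APts of exp & exp
| AStar of assn & assn.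

Definition AOr P Q := ANot (AAnd (ANot P) (ANot Q)).
Definition AExists x P := ANot (AForall x (ANot P)).

Fixpoint pts_from (e : exp) (k : nat) (es : seq exp) : assn :=
  match es with
  | [::] => AEmp
  | [:: e'] => APts (EAdd e (EInt k%:Z)) e'
  | e' :: es' => AStar (APts (EAdd e (EInt k%:Z)) e') (pts_from e k.+1 es')
  end.

(* e |-> e1, ..., en for the nonempty list e1 :: es. *)
Definition pts_list (e e1 : exp) (es : seq exp) : assn :=
  if es is [::] then APts e e1 else AStar (APts e e1) (pts_from e 1 es).

Fixpoint fv_exp (e : exp) : set Var :=
  match e with
  | EVar x => [set x]
  | EInt _ => set0
  | EAdd e1 e2 | ESub e1 e2 | EMul e1 e2 => fv_exp e1 `|` fv_exp e2
  end.

Fixpoint fv_bexp (B : bexp) : set Var :=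
  match B with
  | BTrue | BFalse => set0
  | BEq e1 e2 | BLt e1 e2 => fv_exp e1 `|` fv_exp e2
  | BAnd B1 B2 => fv_bexp B1 `|` fv_bexp B2
  | BNot B1 => fv_bexp B1
  end.

Fixpoint fv_assn (P : assn) : set Var :=
  match P with
  | ABool B => fv_bexp B
  | ANot P1 => fv_assn P1
  | AAnd P1 P2 | AStar P1 P2 => fv_assn P1 `|` fv_assn P2
  | AForall x P1 => fv_assn P1 `\` [set x]
  | AEmp => set0
  | APts e1 e2 => fv_exp e1 `|` fv_exp e2
  end.

(* Simultaneous substitution of expressions for variables. *)
Definition subst := Var -> exp.

Definition subst_upd (d : subst) (x : Var) (e : exp) : subst :=
  fun y => if y == x then e else d y.

Definition subst1 (x : Var) (e : exp) : subst := subst_upd EVar x e.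

Fixpoint exp_subst (d : subst) (e : exp) : exp :=
  match e with
  | EVar x => d x
  | EInt n => EInt n
  | EAdd e1 e2 => EAdd (exp_subst d e1) (exp_subst d e2)
  | ESub e1 e2 => ESub (exp_subst d e1) (exp_subst d e2)
  | EMul e1 e2 => EMul (exp_subst d e1) (exp_subst d e2)
  end.

Fixpoint bexp_subst (d : subst) (B : bexp) : bexp :=
  match B with
  | BTrue => BTrue
  | BFalse => BFalse
  | BEq e1 e2 => BEq (exp_subst d e1) (exp_subst d e2)
  | BLt e1 e2 => BLt (exp_subst d e1) (exp_subst d e2)
  | BAnd B1 B2 => BAnd (bexp_subst d B1) (bexp_subst d B2)
  | BNot B1 => BNot (bexp_subst d B1)
  end.

(* Bound variables are not renamed: this is meaningful only under
   [subst_free], which says that no variable gets captured. *)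
Fixpoint assn_subst (d : subst) (P : assn) : assn :=
  match P with
  | ABool B => ABool (bexp_subst d B)
  | ANot P1 => ANot (assn_subst d P1)
  | AAnd P1 P2 => AAnd (assn_subst d P1) (assn_subst d P2)
  | AForall x P1 => AForall x (assn_subst (subst_upd d x (EVar x)) P1)
  | AEmp => AEmp
  | APts e1 e2 => APts (exp_subst d e1) (exp_subst d e2)
  | AStar P1 P2 => AStar (assn_subst d P1) (assn_subst d P2)
  end.

Fixpoint subst_free (d : subst) (P : assn) : Prop :=
  match P with
  | ABool _ | AEmp | APts _ _ => True
  | ANot P1 => subst_free d P1
  | AAnd P1 P2 | AStar P1 P2 => subst_free d P1 /\ subst_free d P2
  | AForall x P1 =>
      (forall y, fv_assn P1 y -> y <> x -> ~ fv_exp (d y) x) /\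
      subst_free (subst_upd d x (EVar x)) P1
  end.

End Expressions.

Arguments exp : clear implicits.
Arguments bexp : clear implicits.
Arguments assn : clear implicits.
Arguments subst : clear implicits.

Section Commands.
Context {Var Res : eqType}.

Inductive bcmd :=
| Assign of Var & exp Var
| Lookup of Var & exp Var
| Mutate of exp Var & exp Var
| Cons of Var & exp Var & seq (exp Var) (* x := cons(e1, es), at least one cell *)
| Dispose of exp Var.

(* The extended language. *)
Inductive cmd :=
| Skip
| Basic of bcmd
| Seq of cmd & cmd
| If of bexp Var & cmd & cmd
| While of bexp Var & cmd
| Resource of Res & cmd
| With of Res & bexp Var & cmd
| Par of cmd & cmd
| Within of Res & cmd.

Fixpoint unextended (C : cmd) : bool :=
  match C with
  | Skip | Basic _ => true
  | Seq C1 C2 | If _ C1 C2 | Par C1 C2 => unextended C1 && unextended C2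
  | While _ C1 | Resource _ C1 | With _ _ C1 => unextended C1
  | Within _ _ => false
  end.

Definition mod_bcmd (c : bcmd) : set Var :=
  match c with
  | Assign x _ | Lookup x _ | Cons x _ _ => [set x]
  | Mutate _ _ | Dispose _ => set0
  end.

Fixpoint mod_cmd (C : cmd) : set Var :=
  match C with
  | Skip => set0
  | Basic c => mod_bcmd c
  | Seq C1 C2 | If _ C1 C2 | Par C1 C2 => mod_cmd C1 `|` mod_cmd C2
  | While _ C1 | Resource _ C1 | With _ _ C1 | Within _ C1 => mod_cmd C1
  end.

Definition fv_exps (es : seq (exp Var)) : set Var :=
  foldr (fun e X => fv_exp e `|` X) set0 es.

Definition fv_bcmd (c : bcmd) : set Var :=
  match c with
  | Assign x e | Lookup x e => [set x] `|` fv_exp e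
  | Mutate e e' => fv_exp e `|` fv_exp e'
  | Cons x e1 es => [set x] `|` fv_exps (e1 :: es)
  | Dispose e => fv_exp e
  end.

Fixpoint fv_cmd (C : cmd) : set Var :=
  match C with
  | Skip => set0
  | Basic c => fv_bcmd c
  | Seq C1 C2 | Par C1 C2 => fv_cmd C1 `|` fv_cmd C2
  | If B C1 C2 => fv_bexp B `|` (fv_cmd C1 `|` fv_cmd C2)
  | While B C1 | With _ B C1 => fv_bexp B `|` fv_cmd C1
  | Resource _ C1 | Within _ C1 => fv_cmd C1
  end.

Fixpoint res_cmd (C : cmd) : set Res :=
  match C with
  | Skip | Basic _ => set0
  | Seq C1 C2 | If _ C1 C2 | Par C1 C2 => res_cmd C1 `|` res_cmd C2
  | While _ C1 => res_cmd C1
  | Resource r C1 | With r _ C1 | Within r C1 => [set r] `|` res_cmd C1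
  end.

Definition rename_res (r r' q : Res) : Res := if q == r then r' else q.

(* Every occurrence of r is renamed, also the binding ones: the rule REN serves
   to rename the resource declared by a block. *)
Fixpoint rename_cmd (r r' : Res) (C : cmd) : cmd :=
  match C with
  | Skip => Skip
  | Basic c => Basic c
  | Seq C1 C2 => Seq (rename_cmd r r' C1) (rename_cmd r r' C2)
  | If B C1 C2 => If B (rename_cmd r r' C1) (rename_cmd r r' C2)
  | While B C1 => While B (rename_cmd r r' C1)
  | Resource q C1 => Resource (rename_res r r' q) (rename_cmd r r' C1)
  | With q B C1 => With (rename_res r r' q) B (rename_cmd r r' C1)
  | Par C1 C2 => Par (rename_cmd r r' C1) (rename_cmd r r' C2)
  | Within q C1 => Within (rename_res r r' q) (rename_cmd r r' C1)
  end.

Fixpoint auxiliary (X : set Var) (C : cmd) : Prop :=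
  match C with
  | Skip => True
  | Basic (Assign x e) => X x \/ (fv_exp e `&` X = set0)
  | Basic c => fv_bcmd c `&` X = set0
  | Seq C1 C2 | Par C1 C2 => auxiliary X C1 /\ auxiliary X C2
  | If B C1 C2 =>
      [/\ fv_bexp B `&` X = set0, auxiliary X C1 & auxiliary X C2]
  | While B C1 | With _ B C1 => fv_bexp B `&` X = set0 /\ auxiliary X C1
  | Resource _ C1 | Within _ C1 => auxiliary X C1
  end.

Fixpoint erase (X : set Var) (C : cmd) : cmd :=
  match C with
  | Skip => Skip
  | Basic (Assign x e) => if `[< X x >] then Skip else Basic (Assign x e)
  | Basic c => Basic c
  | Seq C1 C2 => Seq (erase X C1) (erase X C2)
  | If B C1 C2 => If B (erase X C1) (erase X C2)
  | While B C1 => While B (erase X C1)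
  | Resource r C1 => Resource r (erase X C1)
  | With r B C1 => With r B (erase X C1)
  | Par C1 C2 => Par (erase X C1) (erase X C2)
  | Within r C1 => Within r (erase X C1)
  end.

Fixpoint locked (C : cmd) : set Res :=
  match C with
  | Seq C1 _ => locked C1
  | Par C1 C2 => locked C1 `|` locked C2
  | Resource r C1 => locked C1 `\` [set r]
  | Within r C1 => locked C1 `|` [set r]
  | _ => set0
  end.

(* Substitution in a basic command; a modified variable x is sent to the
   variable d x, see [subst_ok]. *)
Definition subst_target (d : subst Var) (x : Var) : Var :=
  if d x is EVar y then y else x.

Definition bcmd_subst (d : subst Var) (c : bcmd) : bcmd :=
  match c with
  | Assign x e => Assign (subst_target d x) (exp_subst d e)
  | Lookup x e => Lookup (subst_target d x) (exp_subst d e)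
  | Mutate e e' => Mutate (exp_subst d e) (exp_subst d e')
  | Cons x e1 es =>
      Cons (subst_target d x) (exp_subst d e1) (map (exp_subst d) es)
  | Dispose e => Dispose (exp_subst d e)
  end.

(* A modified variable is replaced by a variable that does not occur in what
   is substituted for the other variables in V. *)
Definition subst_ok (d : subst Var) (c : bcmd) (V : set Var) : Prop :=
  forall x, mod_bcmd c x ->
    exists2 y, d x = EVar y & forall z, V z -> z <> x -> ~ fv_exp (d z) y.

End Commands.

Arguments bcmd : clear implicits.
Arguments cmd : clear implicits.

Section Semantics.
Context {Var Res : eqType} {Val : valueType} {Loc : pred nat}.

Definition loc : choiceType := {l : nat | Loc l}.
Definition store := Var -> Val.
Definition heap := {fmap loc -> Val}.

Implicit Types (s : store) (h g : heap).

Definition upd (s : store) (x : Var) (v : Val) : store :=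
  fun y => if y == x then v else s y.

Fixpoint eval (s : store) (e : exp Var) : Val :=
  match e with
  | EVar x => s x
  | EInt n => vint Val n
  | EAdd e1 e2 => vadd (eval s e1) (eval s e2)
  | ESub e1 e2 => vsub (eval s e1) (eval s e2)
  | EMul e1 e2 => vmul (eval s e1) (eval s e2)
  end.

Fixpoint beval (s : store) (B : bexp Var) : bool :=
  match B with
  | BTrue => true
  | BFalse => false
  | BEq e1 e2 => eval s e1 == eval s e2
  | BLt e1 e2 => vlt (eval s e1) (eval s e2)
  | BAnd B1 B2 => beval s B1 && beval s B2
  | BNot B1 => ~~ beval s B1
  end.

Definition hdisj (h g : heap) : Prop := [disjoint domf h & domf g]%fset.

(* [catf] is the union of finite maps, right-biased where they overlap. *)
Definition hunion (h g : heap) : heap := catf h g.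

Definition subheap (h' h : heap) : Prop :=
  forall l : loc, l \in domf h' -> h.[? l]%fmap = h'.[? l]%fmap.

Definition loc_val (l : loc) : Val := vint Val (val l)%:Z.

Fixpoint sat (s : store) (h : heap) (P : assn Var) : Prop :=
  match P with
  | ABool B => beval s B = true
  | ANot P1 => ~ sat s h P1
  | AAnd P1 P2 => sat s h P1 /\ sat s h P2
  | AForall x P1 => forall v : Val, sat (upd s x v) h P1
  | AEmp => h = [fmap]%fmap
  | APts e e' => exists2 l : loc,
      eval s e = loc_val l & h = [fmap].[l <- eval s e']%fmap
  | AStar P1 P2 => exists h1 h2,
      [/\ hdisj h1 h2, h = hunion h1 h2, sat s h1 P1 & sat s h2 P2]
  end.

Definition entails (P Q : assn Var) : Prop :=
  forall s h, sat s h P -> sat s h Q.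

Definition precise (P : assn Var) : Prop :=
  forall s h h1 h2, subheap h1 h -> subheap h2 h ->
    sat s h1 P -> sat s h2 P -> h1 = h2.

(* g consists of the consecutive locations l, l+1, ... holding vs. *)
Definition block (l : nat) (vs : seq Val) (g : heap) : Prop :=
  (forall i, i < size vs -> Loc (l + i)) /\
  (forall k : loc,
     g.[? k]%fmap = if l <= val k then onth vs (val k - l) else None).

Inductive bexec : bcmd Var -> store * heap -> store * heap -> Prop :=
| Bexec_assign x e s h :
    bexec (Assign x e) (s, h) (upd s x (eval s e), h)
| Bexec_lookup x e s h l v :
    eval s e = loc_val l -> h.[? l]%fmap = Some v ->
    bexec (Lookup x e) (s, h) (upd s x v, h)
| Bexec_mutate e e' s h l :
    eval s e = loc_val l -> l \in domf h ->
    bexec (Mutate e e') (s, h) (s, h.[l <- eval s e']%fmap)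
| Bexec_cons x e1 es s h l g :
    block l (map (eval s) (e1 :: es)) g -> hdisj h g ->
    bexec (Cons x e1 es) (s, h) (upd s x (vint Val l%:Z), hunion h g)
| Bexec_dispose e s h l :
    eval s e = loc_val l -> l \in domf h ->
    bexec (Dispose e) (s, h) (s, h.[~ l]%fmap).

Definition babort (c : bcmd Var) (s : store) (h : heap) : Prop :=
  match c with
  | Lookup _ e | Mutate e _ | Dispose e =>
      ~ exists2 l : loc, eval s e = loc_val l & l \in domf h
  | Assign _ _ | Cons _ _ _ => False
  end.

Definition disj3 (O L D : set Res) : Prop :=
  [/\ O `&` L = set0, O `&` D = set0 & L `&` D = set0].

Record rconf := RConf_ {
  rO : set Res;
  rL : set Res;
  rD : set Res;
  rconf_disj : disj3 rO rL rD
}.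

Definition RConf O L D (H : disj3 O L D) : rconf := RConf_ H.

Definition in_rconf (r : Res) (rho : rconf) : Prop :=
  [\/ rO rho r, rL rho r | rD rho r].

Lemma disj3_del r O L D : disj3 O L D ->
  disj3 (O `\` [set r]) (L `\` [set r]) (D `\` [set r]).
Proof.
by case=> OL OD LD; split; rewrite -subset0 => x [[xA _] [xB _]];
  [rewrite -OL | rewrite -OD | rewrite -LD].
Qed.

Definition rconf_del (r : Res) (rho : rconf) : rconf :=
  RConf (disj3_del r (rconf_disj rho)).

Lemma disj3_init D : disj3 set0 set0 D.
Proof. by split; rewrite set0I. Qed.

Definition rconf_init (D : set Res) : rconf := RConf (disj3_init D).

Definition state := (store * heap * rconf)%type.

Inductive pconf :=
| Run of cmd Var Res & state
| Abort.

(* [RConf H] is the triple (O, L, D), where H : disj3 O L D says that it is a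
   resource configuration. *)
Inductive pstep : pconf -> pconf -> Prop :=
| Step_S1 C2 sg :
    pstep (Run (Seq Skip C2) sg) (Run C2 sg)
| Step_S2 C1 C1' C2 sg sg' :
    pstep (Run C1 sg) (Run C1' sg') ->
    pstep (Run (Seq C1 C2) sg) (Run (Seq C1' C2) sg')
| Step_LP B C sg :
    pstep (Run (While B C) sg) (Run (If B (Seq C (While B C)) Skip) sg)
| Step_IF1 B C1 C2 s h rho :
    beval s B = true ->
    pstep (Run (If B C1 C2) (s, h, rho)) (Run C1 (s, h, rho))
| Step_IF2 B C1 C2 s h rho :
    beval s B = false ->
    pstep (Run (If B C1 C2) (s, h, rho)) (Run C2 (s, h, rho))
| Step_P1 C1 C1' C2 sg sg' :
    pstep (Run C1 sg) (Run C1' sg') ->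
    pstep (Run (Par C1 C2) sg) (Run (Par C1' C2) sg')
| Step_P2 C1 C2 C2' sg sg' :
    pstep (Run C2 sg) (Run C2' sg') ->
    pstep (Run (Par C1 C2) sg) (Run (Par C1 C2') sg')
| Step_P3 sg :
    pstep (Run (Par Skip Skip) sg) (Run Skip sg)
| Step_R0 r s h rho :
    ~ in_rconf r rho ->
    pstep (Run (Resource r Skip) (s, h, rho)) (Run Skip (s, h, rho))
| Step_R1 r C C' s h s' h' O L D (H : disj3 O L D)
    (H1 : disj3 (O `|` [set r]) L D) rho' :
    ~ in_rconf r (RConf H) -> locked C r ->
    pstep (Run C (s, h, RConf H1)) (Run C' (s', h', rho')) ->
    pstep (Run (Resource r C) (s, h, RConf H))
          (Run (Resource r C') (s', h', rconf_del r rho'))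
| Step_R2 r C C' s h s' h' O L D (H : disj3 O L D)
    (H1 : disj3 O L (D `|` [set r])) rho' :
    ~ in_rconf r (RConf H) -> ~ locked C r ->
    pstep (Run C (s, h, RConf H1)) (Run C' (s', h', rho')) ->
    pstep (Run (Resource r C) (s, h, RConf H))
          (Run (Resource r C') (s', h', rconf_del r rho'))
| Step_W0 r B C s h O L D (H : disj3 O L (D `|` [set r]))
    (H1 : disj3 (O `|` [set r]) L D) :
    beval s B = true ->
    pstep (Run (With r B C) (s, h, RConf H))
          (Run (Within r C) (s, h, RConf H1))
| Step_W1 r C C' s h s' h' O L D O' L' D' (H : disj3 O L D)
    (H1 : disj3 (O `\` [set r]) L D) (H2 : disj3 O' L' D')
    (H3 : disj3 (O' `|` [set r]) L' D') :
    O r ->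
    pstep (Run C (s, h, RConf H1)) (Run C' (s', h', RConf H2)) ->
    pstep (Run (Within r C) (s, h, RConf H))
          (Run (Within r C') (s', h', RConf H3))
| Step_W2 r s h O L D (H : disj3 (O `|` [set r]) L D)
    (H1 : disj3 O L (D `|` [set r])) :
    pstep (Run (Within r Skip) (s, h, RConf H))
          (Run Skip (s, h, RConf H1))
| Step_BCT c s h s' h' rho :
    bexec c (s, h) (s', h') ->
    pstep (Run (Basic c) (s, h, rho)) (Run Skip (s', h', rho))
| Step_RA r C s h rho :
    in_rconf r rho ->
    pstep (Run (Resource r C) (s, h, rho)) Abort
| Step_WA r B C s h rho :
    ~ in_rconf r rho ->
    pstep (Run (With r B C) (s, h, rho)) Abort
| Step_RA1 r C s h O L D (H : disj3 O L D)
    (H1 : disj3 (O `|` [set r]) L D) :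
    locked C r ->
    pstep (Run C (s, h, RConf H1)) Abort ->
    pstep (Run (Resource r C) (s, h, RConf H)) Abort
| Step_RA2 r C s h O L D (H : disj3 O L D)
    (H1 : disj3 O L (D `|` [set r])) :
    ~ locked C r ->
    pstep (Run C (s, h, RConf H1)) Abort ->
    pstep (Run (Resource r C) (s, h, RConf H)) Abort
| Step_BCA c s h rho :
    babort c s h ->
    pstep (Run (Basic c) (s, h, rho)) Abort
| Step_SA C1 C2 sg :
    pstep (Run C1 sg) Abort ->
    pstep (Run (Seq C1 C2) sg) Abort
| Step_WA1 r C s h rho :
    pstep (Run C (s, h, rconf_del r rho)) Abort ->
    pstep (Run (Within r C) (s, h, rho)) Abort
| Step_WA2 r C s h O L D (H : disj3 O L D) :
    ~ O r ->
    pstep (Run (Within r C) (s, h, RConf H)) Abort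
| Step_PA1 C1 C2 sg :
    pstep (Run C1 sg) Abort ->
    pstep (Run (Par C1 C2) sg) Abort
| Step_PA2 C1 C2 sg :
    pstep (Run C2 sg) Abort ->
    pstep (Run (Par C1 C2) sg) Abort.

Fixpoint pstepn (k : nat) (c c' : pconf) : Prop :=
  if k is k'.+1 then exists2 c1, pstep c c1 & pstepn k' c1 c' else c = c'.

End Semantics.

Arguments store : clear implicits.
Arguments heap : clear implicits.
Arguments entails {Var} Val Loc P Q.
Arguments precise {Var} Val Loc P.

Section Contexts.
Context {Var Res : eqType}.

(* The entry r(X) : R. *)
Record rentry := REntry {
  rname : Res;
  rvars : set Var;
  rinv : assn Var
}.

Definition rctx := seq rentry.

Definition res_ctx (G : rctx) : set Res := [set r | r \in map rname G].

Definition pv_ctx (G : rctx) : set Var :=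
  [set x | exists2 E, List.In E G & rvars E x].

Definition inv_ctx (G : rctx) : assn Var :=
  foldr (fun E P => AStar (rinv E) P) AEmp G.

Definition rename_ctx (r r' : Res) (G : rctx) : rctx :=
  [seq REntry (rename_res r r' (rname E)) (rvars E) (rinv E) | E <- G].

Definition is_rctx (Val : valueType) (Loc : pred nat) (G : rctx) : Prop :=
  uniq (map rname G) /\
  (forall E, List.In E G ->
     precise Val Loc (rinv E) /\ fv_assn (rinv E) `<=` rvars E).

End Contexts.

Arguments rentry : clear implicits.
Arguments rctx : clear implicits.

Section Validity.
Context {Var Res : eqType} (Val : valueType) (Loc : pred nat).

Definition valid (G : rctx Var Res) (P : assn Var) (C : cmd Var Res)
    (Q : assn Var) : Prop :=
  forall (s : store Var Val) (h : heap Val Loc),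
    sat s h (AStar P (inv_ctx G)) ->
    (forall k, ~ pstepn k (Run C (s, h, rconf_init (res_ctx G))) Abort) /\
    (forall k s' h',
       pstepn k (Run C (s, h, rconf_init (res_ctx G)))
                (Run Skip (s', h', rconf_init (res_ctx G))) ->
       sat s' h' (AStar Q (inv_ctx G))).

End Validity.

Section ProofSystems.
Context {Var Res : eqType} (Val : valueType) (Loc : pred nat).

(* Sequential separation logic for basic commands: Reynolds' local axioms for
   assignment, lookup, mutation, allocation and deallocation, and the structural
   rules.  The rules for compound commands do not apply to a basic command. *)
Inductive sl : assn Var -> bcmd Var -> assn Var -> Prop :=
| SL_assign x e Q :
    subst_free (subst1 x e) Q ->
    sl (assn_subst (subst1 x e) Q) (Assign x e) Q
| SL_lookup_nonint x x2 e :
    ~ fv_exp e x -> x <> x2 ->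
    sl (APts e (EVar x2))
       (Lookup x e)
       (AAnd (ABool (BEq (EVar x) (EVar x2))) (APts e (EVar x2)))
| SL_lookup x x1 x2 e :
    x <> x1 -> x <> x2 -> x1 <> x2 ->
    sl (AAnd (ABool (BEq (EVar x) (EVar x1))) (APts e (EVar x2)))
       (Lookup x e)
       (AAnd (ABool (BEq (EVar x) (EVar x2)))
             (APts (exp_subst (subst1 x (EVar x1)) e) (EVar x2)))
| SL_mutate e e' x :
    ~ fv_exp e x ->
    sl (AExists x (APts e (EVar x))) (Mutate e e') (APts e e')
| SL_cons_nonint x e1 es :
    ~ fv_exps (e1 :: es) x ->
    sl AEmp (Cons x e1 es) (pts_list (EVar x) e1 es)
| SL_cons x x1 e1 es :
    x <> x1 ->
    sl (AAnd (ABool (BEq (EVar x) (EVar x1))) AEmp)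
       (Cons x e1 es)
       (pts_list (EVar x) (exp_subst (subst1 x (EVar x1)) e1)
                 (map (exp_subst (subst1 x (EVar x1))) es))
| SL_dispose e x :
    ~ fv_exp e x ->
    sl (AExists x (APts e (EVar x))) (Dispose e) AEmp
| SL_conseq P P' c Q Q' :
    entails Val Loc P' P -> sl P c Q -> entails Val Loc Q Q' -> sl P' c Q'
| SL_frame P c Q R :
    sl P c Q -> mod_bcmd c `&` fv_assn R = set0 ->
    sl (AStar P R) c (AStar Q R)
| SL_conj P1 P2 c Q1 Q2 :
    sl P1 c Q1 -> sl P2 c Q2 -> sl (AAnd P1 P2) c (AAnd Q1 Q2)
| SL_disj P1 P2 c Q1 Q2 :
    sl P1 c Q1 -> sl P2 c Q2 -> sl (AOr P1 P2) c (AOr Q1 Q2)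
| SL_exists x P c Q :
    sl P c Q -> ~ fv_bcmd c x -> sl (AExists x P) c (AExists x Q)
| SL_forall x P c Q :
    sl P c Q -> ~ fv_bcmd c x -> sl (AForall x P) c (AForall x Q)
| SL_subst d P c Q :
    sl P c Q -> subst_free d P -> subst_free d Q ->
    subst_ok d c (fv_assn P `|` fv_bcmd c `|` fv_assn Q) ->
    sl (assn_subst d P) (bcmd_subst d c) (assn_subst d Q).

Definition wf_spec (G : rctx Var Res) (A : set Var) (P : assn Var)
    (C : cmd Var Res) (Q : assn Var) : Prop :=
  [/\ is_rctx Val Loc G,
      fv_assn P `|` fv_assn Q `<=` A
    & fv_cmd C `<=` A `|` pv_ctx G].

(* Contexts are read up to the order of their entries: the entry r(X) : R that
   is added to a context may stand at any position.  Otherwise CR would only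
   give access to the last resource. *)
Inductive csl : rctx Var Res -> set Var -> assn Var -> cmd Var Res ->
    assn Var -> Prop :=
| CSL_SKP G A P :
    wf_spec G A P Skip P ->
    csl G A P Skip P
| CSL_BC G A P c Q :
    wf_spec G A P (Basic c) Q ->
    sl P c Q -> mod_bcmd c `&` pv_ctx G = set0 ->
    csl G A P (Basic c) Q
| CSL_SEQ G A1 A2 P1 P2 P3 C1 C2 :
    wf_spec G (A1 `|` A2) P1 (Seq C1 C2) P3 ->
    csl G A1 P1 C1 P2 -> csl G A2 P2 C2 P3 ->
    csl G (A1 `|` A2) P1 (Seq C1 C2) P3
| CSL_FRA G A P C Q R :
    wf_spec G (A `|` fv_assn R) (AStar P R) C (AStar Q R) ->
    csl G A P C Q -> mod_cmd C `&` fv_assn R = set0 ->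
    csl G (A `|` fv_assn R) (AStar P R) C (AStar Q R)
| CSL_LP G A P B C :
    wf_spec G A P (While B C) (AAnd P (ABool (BNot B))) ->
    csl G A (AAnd P (ABool B)) C P ->
    csl G A P (While B C) (AAnd P (ABool (BNot B)))
| CSL_CONJ G A1 A2 P1 P2 C Q1 Q2 :
    wf_spec G (A1 `|` A2) (AAnd P1 P2) C (AAnd Q1 Q2) ->
    csl G A1 P1 C Q1 -> csl G A2 P2 C Q2 ->
    csl G (A1 `|` A2) (AAnd P1 P2) C (AAnd Q1 Q2)
| CSL_IF G A1 A2 P B C1 C2 Q :
    wf_spec G (A1 `|` A2) P (If B C1 C2) Q ->
    csl G A1 (AAnd P (ABool B)) C1 Q ->
    csl G A2 (AAnd P (ABool (BNot B))) C2 Q ->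
    csl G (A1 `|` A2) P (If B C1 C2) Q
| CSL_CONS G A A' P P' C Q Q' :
    wf_spec G A' P' C Q' ->
    csl G A P C Q -> entails Val Loc P' P -> entails Val Loc Q Q' ->
    A `<=` A' ->
    csl G A' P' C Q'
| CSL_AUX G A X P C Q :
    wf_spec G A P (erase X C) Q ->
    csl G (A `|` X) P C Q ->
    X `&` (fv_assn P `|` fv_assn Q) = set0 -> X `&` pv_ctx G = set0 ->
    auxiliary X C ->
    csl G A P (erase X C) Q
| CSL_REN G A P C Q r r' :
    wf_spec G A P C Q ->
    csl (rename_ctx r r' G) A P (rename_cmd r r' C) Q ->
    ~ res_cmd C r' -> ~ res_ctx G r' ->
    csl G A P C Q
| CSL_PAR G A1 A2 P1 P2 C1 C2 Q1 Q2 :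
    wf_spec G (A1 `|` A2) (AStar P1 P2) (Par C1 C2) (AStar Q1 Q2) ->
    csl G A1 P1 C1 Q1 -> csl G A2 P2 C2 Q2 ->
    mod_cmd C1 `&` A2 = set0 -> mod_cmd C2 `&` A1 = set0 ->
    csl G (A1 `|` A2) (AStar P1 P2) (Par C1 C2) (AStar Q1 Q2)
| CSL_CR G1 G2 A X P B C Q R r :
    wf_spec (G1 ++ REntry r X R :: G2) A P (With r B C) Q ->
    csl (G1 ++ G2) (A `|` X) (AStar (AAnd P (ABool B)) R) C (AStar Q R) ->
    csl (G1 ++ REntry r X R :: G2) A P (With r B C) Q
| CSL_RES G1 G2 A X P C Q R r :
    wf_spec (G1 ++ G2) (A `|` X) (AStar P R) (Resource r C) (AStar Q R) ->
    csl (G1 ++ REntry r X R :: G2) A P C Q ->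
    csl (G1 ++ G2) (A `|` X) (AStar P R) (Resource r C) (AStar Q R).

End ProofSystems.

(* Main.v *)
(* A step of a reachable configuration is determined by the command, the store,
   the heap and the set D of available resources, since the held ones can be
   read off the command; this yields a transition relation without resource
   configurations.  Over it, [safe n] says that for n steps the command does not
   abort, leaves alone the environment's heap and the variables protected by
   resources it does not hold, and keeps its own heap apart from the heap of the
   invariants of D, whatever the environment does between two steps to D, to its
   own heap and to the variables outside the rely-set.  Each proof rule preserves
   safety.  Parallel composition works because each thread sees the steps of the
   other as moves of the environment; the conjunction rule works because precise
   invariants determine how the heap splits; the erasure of auxiliary variables
   is simulated by a run of the original command on a store that differs only at
   the erased variables. *)
Require Import Defs.
From mathcomp Require Import all_boot all_order all_algebra finmap.
From mathcomp Require Import boolp classical_sets.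
From Stdlib Require List.

Set Implicit Arguments.
Unset Strict Implicit.
Unset Printing Implicit Defensive.

Local Open Scope classical_set_scope.

(* Without this, [locked] is the constant of ssreflect. *)
Local Notation locked := Defs.locked.

(** Validity speaks only of complete runs without interference, so it cannot itself be the induction
    hypothesis: in [CSL_PAR] each premise must say what happens when another thread acts between two
    steps. The step index turns the stronger property into a plain recursion and gives the loop
    something to induct on. The variables that a thread may count on are the rely-set of its
    judgement and those protected by the resources it holds, because no thread writes a variable
    protected by a resource that it does not hold. The promise given in return concerns only such
    protected variables; for the variables in the rely-set of the other thread, the side conditions
    of [CSL_PAR] on modified variables take over. Two rules transform the command as a whole.
    [CSL_AUX] changes the number of steps, so one step of the erased command consumes several units
    of the index. In [CSL_REN] the renaming is not injective on names; its side conditions allow it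
    to be replaced by a transposition, under which the semantics is invariant. *)

(** * Heaps *)

Section Heaps.
Context {Val : valueType} {Loc : pred nat}.
Notation heap := (heap Val Loc).
Implicit Types (a b c d g h : heap) (l : @loc Loc).

Definition hsum h1 h2 h : Prop := hdisj h1 h2 /\ h = hunion h1 h2.

Definition hempty : heap := [fmap]%fmap.
Definition cell l (v : Val) : heap := [fmap].[l <- v]%fmap.

Lemma hsumC h1 h2 h : hsum h1 h2 h -> hsum h2 h1 h.
Proof.
rewrite /hsum /hdisj /hunion => -[dis ->]; split; last exact: disjoint_catfC.
by rewrite fdisjoint_sym.
Qed.

Lemma hsumA a b ab c h : hsum a b ab -> hsum ab c h ->
  exists2 bc, hsum b c bc & hsum a bc h.
Proof.
rewrite /hsum /hdisj /hunion => -[dab ->] [].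
rewrite domf_cat fdisjointUX => /andP[dac dbc] ->.
exists (catf b c); first by [].
by rewrite domf_cat fdisjointXU dab dac catfA.
Qed.

Lemma hsumCA a b c d h : hsum a b h -> hsum c d b ->
  exists2 e, hsum a d e & hsum c e h.
Proof.
move=> Hab Hcd; have [e He Hce] := hsumA Hcd (hsumC Hab).
by exists e => //; exact: hsumC.
Qed.

Lemma hsum0h h : hsum hempty h h.
Proof. by split; [exact: fdisjoint0X | rewrite /hunion cat0f]. Qed.

Lemma hsumh0 h : hsum h hempty h.
Proof. exact/hsumC/hsum0h. Qed.

Lemma hsum0E h g : hsum h hempty g -> g = h.
Proof. by case=> _ ->; rewrite /hunion catf0. Qed.

Lemma hsum_inj a b c h : hsum a c h -> hsum b c h -> a = b.
Proof. by move=> [dac ->] [dbc]; apply: disjoint_catfIs. Qed.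

Lemma hsum_fun a b g h : hsum a b g -> hsum a b h -> g = h.
Proof. by move=> [_ ->] [_ ->]. Qed.

Lemma hsum_subheap h1 h2 h : hsum h1 h2 h -> subheap h1 h.
Proof.
move=> [d ->] l l1; rewrite /hunion fnd_cat ifF //; apply/negbTE.
by move/fdisjointP: d; apply.
Qed.

(** The three slots are meant for the heap of the command, the heap of the available invariants and
    the heap of the environment, in this order. *)
Definition hsum3 h1 h2 h3 h : Prop := exists2 g, hsum h1 h2 g & hsum g h3 h.

(** Ownership transfer on releasing a resource: the part [b] that satisfies the invariant passes
    from the command to the invariants. The converse below is the transfer on acquiring it. *)
Lemma hsum3_assoc a b c d ab h : hsum a b ab -> hsum3 ab c d h ->
  exists2 bc, hsum b c bc & hsum3 a bc d h.
Proof.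
move=> Hab [g Hg Hh]; have [bc Hbc Habc] := hsumA Hab Hg.
by exists bc => //; exists g.
Qed.

Lemma hsum3_unassoc a b c d bc h : hsum b c bc -> hsum3 a bc d h ->
  exists2 ab, hsum a b ab & hsum3 ab c d h.
Proof.
move=> Hbc [g Hg Hh].
have [ab Hab Hcab] := hsumA (hsumC Hbc) (hsumC Hg).
by exists ab; [exact: hsumC | exists g => //; exact: hsumC].
Qed.

(** Here [b] is handed to the environment: a step sees the heap of a sibling thread, or a framed
    heap, in this way. The converse below takes it back after the step. *)
Lemma hsum3_frame a b c d ab h : hsum a b ab -> hsum3 ab c d h ->
  exists2 bd, hsum b d bd & hsum3 a c bd h.
Proof.
move=> Hab [g Hg Hh]; have [ac Hac Hbac] := hsumA (hsumC Hab) Hg.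
have [bd Hbd Hh'] := hsumA (hsumC Hbac) Hh.
by exists bd => //; exists ac.
Qed.

Lemma hsum3_unframe a b c d bd h : hsum b d bd -> hsum3 a c bd h ->
  exists2 ab, hsum a b ab & hsum3 ab c d h.
Proof.
move=> Hbd [ac Hac Hh].
have [x Hx Hh'] := hsumA (hsumC Hbd) (hsumC Hh).
have [ab Hab Habc] := hsumA (hsumC Hac) (hsumC Hx).
by exists ab => //; exists x; exact: hsumC.
Qed.

Lemma fnd_cell l v k : (cell l v).[? k]%fmap = if k == l then Some v else None.
Proof. by rewrite fnd_set fnd_fmap0. Qed.

Lemma cell_at l v hF h : hsum (cell l v) hF h -> h.[? l]%fmap = Some v.
Proof.
move=> /hsum_subheap -> ; first by rewrite fnd_cell eqxx.
by rewrite /cell mem_setf inE eqxx.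
Qed.

Lemma at_dom h l v : h.[? l]%fmap = Some v -> l \in domf h.
Proof. by case: fndP. Qed.

Lemma domf_cell l v : domf (cell l v) = [fset l]%fset.
Proof. by rewrite /cell dom_setf fsetU0. Qed.

Lemma cell_rem l v hF h : hsum (cell l v) hF h -> h.[~ l]%fmap = hF.
Proof.
rewrite /hsum /hdisj domf_cell fdisjoint1X => -[lF ->].
apply/fmapP => k; rewrite /hunion fnd_rem1 fnd_cat fnd_cell.
case: eqVneq => [->|kl]; first by rewrite not_fnd.
by case: ifP => // /negbT kF; rewrite not_fnd.
Qed.

Lemma cell_set l v w hF h : hsum (cell l v) hF h ->
  hsum (cell l w) hF h.[l <- w]%fmap.
Proof.
rewrite /hsum /hdisj !domf_cell !fdisjoint1X => -[lF ->]; split => //.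
apply/fmapP => k.
have E u : ((hunion (cell l u) hF).[? k] =
    if k \in domf hF then hF.[? k] else if k == l then Some u else None)%fmap.
  by rewrite /hunion fnd_cat fnd_cell.
apply: etrans (fnd_set _ _ _ _) _; apply: etrans (esym (E w)).
by rewrite E; case: eqVneq => [->|//]; rewrite (negbTE lF).
Qed.

Lemma loc_val_inj : injective (@loc_val Val Loc).
Proof. by move=> l1 l2 /vint_inj [] /val_inj. Qed.

Lemma block_nil n h : block n [::] h -> h = hempty.
Proof.
by move=> [_ Hh]; apply/fmapP => k; rewrite Hh fnd_fmap0 onth0n if_same.
Qed.

Lemma block_cons n v vs h : block n (v :: vs) h ->
  exists l, exists2 g, val l = n & hsum (cell l v) g h /\ block n.+1 vs g.
Proof.
move=> [HL Hh]; have Ln : Loc n by have := HL 0; rewrite addn0; apply.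
pose l : @loc Loc := Sub n Ln; exists l, h.[~ l]%fmap; first by [].
have hl : h.[? l]%fmap = Some v by rewrite Hh /= leqnn subnn.
split.
  split; first by rewrite /hdisj domf_cell fdisjoint1X mem_remfF.
  apply/fmapP => k; rewrite /hunion fnd_cat fnd_cell fnd_rem1.
  rewrite mem_remf1; case: eqVneq => [->|kl] /=; first by rewrite hl.
  by case: ifP => // /negbT kF; rewrite not_fnd.
split=> [i ile|k]; first by rewrite addSnnS; apply: HL.
rewrite fnd_rem1 Hh; case: eqVneq => [->|kl] /=; first by rewrite ltnn.
have : val k != n by apply: contra kl => /eqP kn; apply/eqP/val_inj.
by case: ltngtP => //= nk _; rewrite -(subnSK nk).
Qed.

End Heaps.

(** * Assertions and substitution *)

Section Assertions.
Context {Var : eqType} {Val : valueType} {Loc : pred nat}.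
Notation store := (store Var Val).
Notation heap := (heap Val Loc).
Implicit Types (s : store) (h g : heap) (P Q R : assn Var) (e : exp Var)
  (d : subst Var) (X : set Var).

Definition agree X s s' : Prop := forall x, X x -> s x = s' x.

Lemma agree_sub X Y s s' : X `<=` Y -> agree Y s s' -> agree X s s'.
Proof. by move=> XY a x /XY; apply: a. Qed.

Lemma agree_sym X s s' : agree X s s' -> agree X s' s.
Proof. by move=> a x /a. Qed.

Lemma agree_trans X s1 s2 s3 : agree X s1 s2 -> agree X s2 s3 -> agree X s1 s3.
Proof. by move=> a b x Xx; rewrite a // b. Qed.

Lemma agree_upd X s x v : ~ X x -> agree X s (upd s x v).
Proof. by move=> nX y Xy; rewrite /upd; case: eqP => // yx;
  rewrite yx in Xy. Qed.

Lemma agree_upd2 X s s' x v :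
  agree (X `\` [set x]) s s' -> agree X (upd s x v) (upd s' x v).
Proof. by move=> a y Xy; rewrite /upd; case: eqP => // yx; apply: a. Qed.

Lemma agreeU X Y s s' : agree X s s' -> agree Y s s' -> agree (X `|` Y) s s'.
Proof. by move=> a b x []; [apply: a | apply: b]. Qed.

Lemma eval_agree e s s' : agree (fv_exp e) s s' -> eval s e = eval s' e.
Proof.
elim: e => //= [x|e1 IH1 e2 IH2|e1 IH1 e2 IH2|e1 IH1 e2 IH2] a;
  first exact: a.
all: by rewrite (IH1 (agree_sub (@subsetUl _ _ _) a))
  (IH2 (agree_sub (@subsetUr _ _ _) a)).
Qed.

Lemma beval_agree (B : bexp Var) s s' :
  agree (fv_bexp B) s s' -> beval s B = beval s' B.
Proof.
elim: B => //= [e1 e2|e1 e2|B1 IH1 B2 IH2|B1 IH1] a; last by rewrite IH1.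
all: have a1 := agree_sub (@subsetUl _ _ _) a.
all: have a2 := agree_sub (@subsetUr _ _ _) a.
- by rewrite (eval_agree a1) (eval_agree a2).
- by rewrite (eval_agree a1) (eval_agree a2).
- by rewrite IH1 ?IH2.
Qed.

Lemma sat_agree P s s' h : agree (fv_assn P) s s' -> sat s h P -> sat s' h P.
Proof.
elim: P s s' h =>
  /= [B|P IH|P1 IH1 P2 IH2|x P IH||e1 e2|P1 IH1 P2 IH2] s s' h a.
- by rewrite (beval_agree a).
- by move=> H H'; apply: H; apply: IH H'; exact: agree_sym.
- move=> [H1 H2]; split; [apply: IH1 H1 | apply: IH2 H2].
  + exact: agree_sub a.
  + exact: agree_sub a.
- by move=> H v; apply: IH (H v); apply: agree_upd2.
- by [].
- have a1 := agree_sub (@subsetUl _ _ _) a.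
  have a2 := agree_sub (@subsetUr _ _ _) a.
  by rewrite (eval_agree a1) (eval_agree a2).
- move=> [h1 [h2 [dis -> H1 H2]]]; exists h1, h2; split => //.
  + by apply: IH1 H1; apply: agree_sub a.
  + by apply: IH2 H2; apply: agree_sub a.
Qed.

Lemma satE_star s h P Q : sat s h (AStar P Q) <->
  exists h1 h2, [/\ hsum h1 h2 h, sat s h1 P & sat s h2 Q].
Proof.
split=> [[h1 [h2 [d e H1 H2]]]|[h1 [h2 [[d e] H1 H2]]]]; by exists h1, h2.
Qed.

Lemma satE_exists s h x P :
  sat s h (AExists x P) <-> exists v, sat (upd s x v) h P.
Proof.
split=> /= [H|[v Hv] H]; last exact: H Hv.
by apply: contrapT => N; apply: H => v Hv; apply: N; exists v.
Qed.

Lemma satE_or s h P Q : sat s h (AOr P Q) <-> sat s h P \/ sat s h Q.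
Proof.
split=> /= [H|[] H [N1 N2]]; [|exact: N1|exact: N2].
by apply: contrapT => N; apply: H; split=> H; apply: N; [left|right].
Qed.

(** Pulling the store back along [d]: syntactic substitution becomes evaluation in this store. *)
Definition subst_store d s : store := fun y => eval s (d y).

Lemma eval_subst d s e : eval s (exp_subst d e) = eval (subst_store d s) e.
Proof. by elim: e => //= [e1 -> e2 ->|e1 -> e2 ->|e1 -> e2 ->]. Qed.

Lemma beval_subst d s (B : bexp Var) :
  beval s (bexp_subst d B) = beval (subst_store d s) B.
Proof.
by elim: B => //= [e1 e2|e1 e2|B1 -> B2 ->|B1 ->//]; rewrite ?eval_subst.
Qed.

Lemma sat_subst d s h P : subst_free d P ->
  sat s h (assn_subst d P) <-> sat (subst_store d s) h P.
Proof.
elim: P d s h => /= [B|P IH|P1 IH1 P2 IH2|x P IH||e1 e2|P1 IH1 P2 IH2] d s h.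
- by rewrite beval_subst.
- by move=> /IH H; split=> N /H.
- by move=> [/IH1 H1 /IH2 H2]; split=> -[/H1 ? /H2 ?].
- move=> [cap /IH {}IH].
  (* Binding [x] commutes with pulling back along [d] on the free variables of the body, because no
     expression substituted for another one mentions [x]. *)
  have a v : agree (fv_assn P) (subst_store (subst_upd d x (EVar x)) (upd s x v))
      (upd (subst_store d s) x v).
    move=> y Py; rewrite /subst_store /subst_upd {2}/upd.
    case: eqP => [_|yx] /=; first by rewrite /upd eqxx.
    by apply/esym/eval_agree/agree_upd/cap.
  split=> H v; first by apply: sat_agree (a v) _; apply/IH.
  by apply/IH; apply: sat_agree (agree_sym (a v)) _.
- by [].
- by rewrite !eval_subst.
- move=> [/IH1 H1 /IH2 H2]; split=> -[h1 [h2 [dis -> /H1 ? /H2 ?]]];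
    by exists h1, h2.
Qed.

Lemma subst_store1 x e s : subst_store (subst1 x e) s = upd s x (eval s e).
Proof.
by apply/funext => y; rewrite /subst_store /subst1 /subst_upd /upd; case: eqP.
Qed.

Lemma sat_pts_from s e n k es h :
  eval s e = vint Val (Posz n) -> block (n + k) (map (eval s) es) h ->
  sat s h (pts_from e k es).
Proof.
move=> en; elim: es k h => [|e1 es IH] k h; first by move/block_nil.
move=> /= /block_cons [l [g lnk [Hg Bg]]].
have lE : eval s (EAdd e (EInt k%:Z)) = loc_val l.
  by rewrite /= en vadd_int /loc_val lnk.
have Hc : sat s (cell l (eval s e1)) (APts (EAdd e (EInt k%:Z)) e1) by exists l.
case: es => [|e2 es] in IH Bg *.
  by move/block_nil: Bg Hg => -> /hsum0E ->.
apply/satE_star; exists (cell l (eval s e1)), g; split => //.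
by apply: IH; rewrite addnS.
Qed.

Lemma sat_pts_list s e n e1 es h :
  eval s e = vint Val (Posz n) -> block n (map (eval s) (e1 :: es)) h ->
  sat s h (pts_list e e1 es).
Proof.
move=> en /= /block_cons [l [g lnk [Hg Bg]]].
have Hc : sat s (cell l (eval s e1)) (APts e e1).
  by exists l => //; rewrite en /loc_val lnk.
case: es => [|e2 es] in Bg *; first by move/block_nil: Bg Hg => -> /hsum0E ->.
apply/satE_star; exists (cell l (eval s e1)), g; split => //.
by apply: sat_pts_from en _; rewrite addn1.
Qed.

End Assertions.

(** * Basic commands *)

Section BasicCommands.
Context {Var : eqType} {Val : valueType} {Loc : pred nat}.
Notation store := (store Var Val).
Notation heap := (heap Val Loc).
Implicit Types (s t : store) (h g : heap) (P Q R : assn Var) (e : exp Var)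
  (d : subst Var) (X : set Var) (c : bcmd Var).

Lemma bexec_mod c s h s' h' : bexec c (s, h) (s', h') ->
  agree (~` mod_bcmd c) s s'.
Proof.
move=> H; inversion H; subst => //=; by apply: agree_upd => /(_ erefl).
Qed.

Lemma evals_agree (es : seq (exp Var)) s t : agree (fv_exps es) s t ->
  map (eval s) es = map (eval t) es.
Proof.
elim: es => //= e es IH a.
by rewrite (eval_agree (agree_sub (@subsetUl _ _ _) a))
  (IH (agree_sub (@subsetUr _ _ _) a)).
Qed.

Lemma babort_agree c s t h : agree (fv_bcmd c) s t ->
  babort c s h -> babort c t h.
Proof.
case: c => //= [x e|e e'|e] a; rewrite (@eval_agree _ _ e s t) //.
  exact: agree_sub (@subsetUr _ _ _) a.
exact: agree_sub (@subsetUl _ _ _) a.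
Qed.

(** A run can be replayed from another store with the same resulting heap, in particular with the
    same block chosen by [Cons]. The quantifier rules and the erasure of auxiliary variables compare
    stores in this way. *)
Lemma bexec_agree c s t h s' h' :
  agree (fv_bcmd c) s t -> bexec c (s, h) (s', h') ->
  exists t', [/\ bexec c (t, h) (t', h'), agree (mod_bcmd c) s' t'
               & agree (~` mod_bcmd c) t t'].
Proof.
move=> a H; inversion H; subst; simpl in *.
- have E : eval s e = eval t e.
    by apply: eval_agree; apply: agree_sub a; exact: subsetUr.
  exists (upd t x (eval t e)); split; first exact: Bexec_assign.
    by move=> y -> /=; rewrite /upd eqxx.
  by apply: agree_upd => /(_ erefl).
- have E : eval s e = eval t e.
    by apply: eval_agree; apply: agree_sub a; exact: subsetUr.
  exists (upd t x v); split; first by apply: (@Bexec_lookup _ _ _ _ _ _ _ l) =>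
    //; rewrite -E.
    by move=> y -> /=; rewrite /upd eqxx.
  by apply: agree_upd => /(_ erefl).
- have E1 := eval_agree (agree_sub (@subsetUl _ _ _) a).
  have E2 := eval_agree (agree_sub (@subsetUr _ _ _) a).
  exists t; split => //.
  by rewrite E2; apply: Bexec_mutate => //; rewrite -E1.
- have E : map (eval s) (e1 :: es) = map (eval t) (e1 :: es).
    by apply: evals_agree; apply: agree_sub a; exact: subsetUr.
  exists (upd t x (vint Val l)); split; first by apply: Bexec_cons => //;
    rewrite -E.
    by move=> y -> /=; rewrite /upd eqxx.
  by apply: agree_upd => /(_ erefl).
- exists t; split => //.
  by apply: Bexec_dispose => //; rewrite -(eval_agree a).
Qed.

Lemma upd_bexec c s x v h s' h' t' : ~ fv_bcmd c x ->
  bexec c (s, h) (s', h') -> agree (mod_bcmd c) s' t' ->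
  agree (~` mod_bcmd c) (upd s x v) t' -> upd s' x v = t'.
Proof.
move=> nx X a1 a2; apply/funext => y; case: (pselect (mod_bcmd c y)) => my.
  rewrite -a1 // /upd; case: eqP => // yx; case: nx; rewrite -yx.
  by case: c my {X a1 a2} => //= *; left.
by rewrite -a2 // /upd; case: eqP => // _; rewrite (bexec_mod X).
Qed.

(** Agreement is limited to [V] because writing the target variable may also change the value of
    [d z] for [z] outside [V]. *)
Lemma bexec_subst d c s h s' h' (V : set Var) :
  fv_bcmd c `<=` V -> subst_ok d c V ->
    bexec (bcmd_subst d c) (s, h) (s', h') ->
  exists t', bexec c (subst_store d s, h) (t', h') /\
    agree V t' (subst_store d s').
Proof.
have tgt x w : V x -> (forall x', x' = x -> exists2 y, d x' = EVar y
      & forall z, V z -> z <> x' -> ~ fv_exp (d z) y) ->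
    agree V (upd (subst_store d s) x w)
      (subst_store d (upd s (subst_target d x) w)).
  move=> Vx /(_ x erefl) [y dx ok] z Vz; rewrite /subst_target dx.
  rewrite {1}/upd; case: eqP => [->|zx]; rewrite /subst_store.
    by rewrite dx /= /upd eqxx.
  exact/eval_agree/agree_upd/ok.
move=> cV ok; case: c => [x e|x e|e e'|x e1 es|e] in cV ok *;
  move=> H; inversion H; subst.
- exists (upd (subst_store d s) x (eval (subst_store d s) e)); split.
    exact: Bexec_assign.
  by rewrite eval_subst; apply: tgt => //; apply: cV; left.
- exists (upd (subst_store d s) x v); split.
    by apply: (@Bexec_lookup _ _ _ _ _ _ _ l) => //; rewrite -eval_subst.
  by apply: tgt => //; apply: cV; left.
- exists (subst_store d s'); split => //.
  by rewrite eval_subst; apply: Bexec_mutate => //; rewrite -eval_subst.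
- exists (upd (subst_store d s) x (vint Val l)); split.
    apply: Bexec_cons => //.
    suff <- : [seq eval s i | i <- exp_subst d e1 :: [seq exp_subst d i | i <- es]]
        = [seq eval (subst_store d s) i | i <- e1 :: es] by [].
    rewrite /= eval_subst -map_comp; congr cons; apply: eq_map => i /=.
    exact: eval_subst.
  by apply: tgt => //; apply: cV; left.
- exists (subst_store d s'); split => //.
  by apply: Bexec_dispose => //; rewrite -eval_subst.
Qed.

Lemma babort_subst d c s h :
  babort (bcmd_subst d c) s h <-> babort c (subst_store d s) h.
Proof. by case: c => //= *; rewrite eval_subst. Qed.

(** The frame [hF] is quantified inside the triple, so locality of the basic commands is part of the
    induction and the frame rule becomes a reassociation of heaps. *)
Definition local_triple P c Q : Prop := forall s h hF H,
  hsum h hF H -> sat s h P ->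
  ~ babort c s H /\
  forall s' H', bexec c (s, H) (s', H') ->
    exists2 h', hsum h' hF H' & sat s' h' Q.

Lemma cell_safe s e l v hF (H : heap) : eval s e = loc_val l ->
  hsum (cell l v) hF H ->
  exists2 l0 : @loc Loc, eval s e = loc_val l0 & l0 \in domf H.
Proof. by move=> el Hs; exists l => //; apply: at_dom (cell_at Hs). Qed.

Lemma lookup_triple Q x e s (l : @loc Loc) v hF H :
  eval s e = loc_val l -> hsum (cell l v) hF H ->
  sat (upd s x v) (cell l v) Q ->
  ~ babort (Lookup x e) s H /\
  forall s' H', bexec (Lookup x e) (s, H) (s', H') ->
    exists2 h', hsum h' hF H' & sat s' h' Q.
Proof.
move=> el Hs HQ; split=> [/(_ (cell_safe el Hs)) //|s' H' X]; inversion X;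
  subst.
have /loc_val_inj ll : loc_val l = loc_val l0 :> Val by rewrite -el.
subst l0; have E := cell_at Hs.
by match goal with h : _ = Some _ |- _ => rewrite E in h; case: h => <- end;
  exists (cell l v).
Qed.

Lemma sl_sound P c Q : sl Val Loc P c Q -> local_triple P c Q.
Proof.
elim=> {P c Q}.
- move=> x e Q fr s h hF H Hs /(sat_subst _ _ fr); rewrite subst_store1 => HQ.
  by split => // s' H' X; inversion X; subst; exists h.
- move=> x x2 e nx xx2 s h hF H Hs [l el E]; subst h.
  apply: (lookup_triple el Hs) => /=.
  have x2E : upd s x (s x2) x2 = s x2 by rewrite /upd; case: eqP => // /esym.
  split; first by rewrite x2E {1}/upd !eqxx.
  exists l; last by rewrite x2E.
  by rewrite -el; apply: eval_agree; apply/agree_sym/agree_upd.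
- move=> x x1 x2 e xx1 xx2 x12 s h hF H Hs [sx [l el E]]; subst h.
  have {}sx : s x = s x1 by apply/eqP.
  apply: (lookup_triple el Hs) => /=.
  have x2E : upd s x (s x2) x2 = s x2 by rewrite /upd; case: eqP => // /esym.
  split; first by rewrite x2E {1}/upd !eqxx.
  exists l; last by rewrite x2E.
  rewrite -el eval_subst subst_store1 /=; congr (eval _ e); apply/funext => y.
  rewrite /upd; case: eqP => // ->; case: eqP => [|_ //]; by move/esym.
- move=> e e' x nx s h hF H Hs /satE_exists [v /= [l el E]]; subst h.
  have {}el : eval s e = loc_val l by rewrite -el; apply/eval_agree/agree_upd.
  split=> [/(_ (cell_safe el Hs)) //|s' H' X]; inversion X; subst.
  have /loc_val_inj ll : loc_val l = loc_val l0 :> Val by rewrite -el.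
  subst l0; exists (cell l (eval s' e')); last by exists l.
  exact: cell_set Hs.
- move=> x e1 es nx s h hF H Hs /= E; subst h.
  split=> // s' H' X; inversion X; subst.
  have {}Hs : H = hF by apply: hsum0E; apply: hsumC.
  subst H; exists g; first exact/hsumC.
  apply: (@sat_pts_list _ _ _ _ _ l); first by rewrite /= /upd eqxx.
  by rewrite -(@evals_agree _ s) //; apply: agree_upd.
- move=> x x1 e1 es xx1 s h hF H Hs [sx E]; subst h.
  have {}sx : s x = s x1 by apply/eqP.
  split=> // s' H' X; inversion X; subst.
  have {}Hs : H = hF by apply: hsum0E; apply: hsumC.
  subst H; exists g; first exact/hsumC.
  apply: (@sat_pts_list _ _ _ _ _ l); first by rewrite /= /upd eqxx.
  have Ee e : eval (upd s x (vint Val l)) (exp_subst (subst1 x (EVar x1)) e) = eval s e.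
    rewrite eval_subst subst_store1 /=; congr (eval _ e); apply/funext => y.
    rewrite /upd; case: eqP => // ->; case: eqP => [|_ //]; by move/esym.
  by rewrite /= Ee -map_comp (eq_map (Ee : _ \o _ =1 _)).
- move=> e x nx s h hF H Hs /satE_exists [v /= [l el E]]; subst h.
  have {}el : eval s e = loc_val l by rewrite -el; apply/eval_agree/agree_upd.
  split=> [/(_ (cell_safe el Hs)) //|s' H' X]; inversion X; subst.
  have /loc_val_inj ll : loc_val l = loc_val l0 :> Val by rewrite -el.
  subst l0; exists hempty => //; rewrite (cell_rem Hs); exact: hsum0h.
- move=> P P' c Q Q' PP _ IH QQ s h hF H Hs /PP /(IH _ _ _ _ Hs) [nab ex].
  by split=> // s' H' /ex [h' Hs' /QQ]; exists h'.
- move=> P c Q R _ IH md s h hF H Hs /satE_star [h1 [h2 [Hh H1 H2]]].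
  have [g Hg Hs'] := hsumA Hh Hs.
  have [nab ex] := IH _ _ _ _ Hs' H1; split=> // s' H' X.
  have [h' Hh' HQ] := ex _ _ X.
  have [k Hk Hk'] := hsumA (hsumC Hg) (hsumC Hh').
  exists k; first exact: hsumC.
  apply/satE_star; exists h', h2; split => //; first exact: hsumC.
  apply: sat_agree H2; apply: agree_sub (bexec_mod X) => y Ry my.
  by have : set0 y by rewrite -md.
- move=> P1 P2 c Q1 Q2 _ IH1 _ IH2 s h hF H Hs [H1 H2].
  have [nab ex1] := IH1 _ _ _ _ Hs H1; have [_ ex2] := IH2 _ _ _ _ Hs H2.
  split=> // s' H' X; have [h1 Hh1 HQ1] := ex1 _ _ X.
  have [h2 Hh2 HQ2] := ex2 _ _ X; exists h1 => //; split=> //.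
  (* Both remainders complement the same [hF] in the same final heap, so they coincide. *)
  by rewrite (hsum_inj Hh1 Hh2).
- move=> P1 P2 c Q1 Q2 _ IH1 _ IH2 s h hF H Hs /satE_or [] HP.
  + have [nab ex] := IH1 _ _ _ _ Hs HP; split=> // s' H' /ex [h' Hh' HQ].
    by exists h' => //; apply/satE_or; left.
  + have [nab ex] := IH2 _ _ _ _ Hs HP; split=> // s' H' /ex [h' Hh' HQ].
    by exists h' => //; apply/satE_or; right.
- move=> x P c Q _ IH nx s h hF H Hs /satE_exists [v HP].
  have a : agree (fv_bcmd c) s (upd s x v) by apply: agree_upd.
  have [nab ex] := IH _ _ _ _ Hs HP; split=> [/(babort_agree a)//|s' H' X].
  have [t' [Xt a1 a2]] := bexec_agree a X.
  have [h' Hh' HQ] := ex _ _ Xt; exists h' => //; apply/satE_exists; exists v.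
  by rewrite (upd_bexec nx X a1 a2).
- move=> x P c Q _ IH nx s h hF H Hs HP.
  have a v : agree (fv_bcmd c) s (upd s x v) by apply: agree_upd.
  split=> [/(babort_agree (a (vnull Val)))|s' H' X].
    by have [] := IH _ _ _ _ Hs (HP (vnull Val)).
  have post v : exists2 h', hsum h' hF H' & sat (upd s' x v) h' Q.
    have [t' [Xt a1 a2]] := bexec_agree (a v) X.
    have [_ /(_ _ _ Xt) [h' Hh' HQ]] := IH _ _ _ _ Hs (HP v).
    by exists h' => //; rewrite (upd_bexec nx X a1 a2).
  (* The postcondition needs one heap for all values [v]. Any value yields a candidate, here
     [vnull], and cancelling [hF] identifies it with the heap of every other value. *)
  have [h' Hh' _] := post (vnull Val); exists h' => // v.
  by have [h2 Hh2] := post v; rewrite (hsum_inj Hh' Hh2).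
- move=> d P c Q _ IH frP frQ ok s h hF H Hs /(sat_subst _ _ frP) HP.
  have [nab ex] := IH _ _ _ _ Hs HP; split=> [/babort_subst //|s' H' X].
  have [|t' [Xt a]] := bexec_subst _ ok X; first by move=> y; left; right.
  have [h' Hh' HQ] := ex _ _ Xt; exists h' => //; apply/(sat_subst _ _ frQ).
  by apply: sat_agree HQ; apply: agree_sub a => y; right.
Qed.

End BasicCommands.

(** * Transitions without resource configurations *)

Section LockFreeSemantics.
Context {Var Res : eqType} {Val : valueType} {Loc : pred nat}.
Notation store := (store Var Val).
Notation heap := (heap Val Loc).
Notation cmd := (cmd Var Res).
Implicit Types (s t : store) (h g : heap) (C : cmd) (K D : set Res).

(** What a block offers to its body: [Step_R1] counts [r] as held when the body holds it, [Step_R2]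
    as available otherwise. One formula covers both rules. *)
Definition open_res (r : Res) C D : set Res :=
  [set q | D q \/ (q = r /\ ~ locked C r)].

(* Transitions with the resource configuration (O, L, D) cut down to
   K = O `|` L `|` D and D: the set O of resources held by C is recovered
   as [locked C], and K never changes. *)
Inductive tstep : set Res -> cmd -> store -> heap -> set Res ->
    cmd -> store -> heap -> set Res -> Prop :=
| T_seq_skip K C2 s h D : tstep K (Seq Skip C2) s h D C2 s h D
| T_seq K C1 C1' C2 s h D s' h' D' :
    tstep K C1 s h D C1' s' h' D' ->
    tstep K (Seq C1 C2) s h D (Seq C1' C2) s' h' D'
| T_while K B C s h D :
    tstep K (While B C) s h D (If B (Seq C (While B C)) Skip) s h D
| T_if K B C1 C2 s h D :
    tstep K (If B C1 C2) s h D (if beval s B then C1 else C2) s h D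
| T_par1 K C1 C1' C2 s h D s' h' D' :
    tstep K C1 s h D C1' s' h' D' ->
    tstep K (Par C1 C2) s h D (Par C1' C2) s' h' D'
| T_par2 K C1 C2 C2' s h D s' h' D' :
    tstep K C2 s h D C2' s' h' D' ->
    tstep K (Par C1 C2) s h D (Par C1 C2') s' h' D'
| T_par_skip K s h D : tstep K (Par Skip Skip) s h D Skip s h D
| T_res_skip K r s h D : ~ K r -> tstep K (Resource r Skip) s h D Skip s h D
| T_res K r C s h D C' s' h' D' : ~ K r ->
    tstep (K `|` [set r]) C s h (open_res r C D) C' s' h' D' ->
    tstep K (Resource r C) s h D (Resource r C') s' h' (D' `\` [set r])
| T_with K r B C s h D : D r -> beval s B = true ->
    tstep K (With r B C) s h D (Within r C) s h (D `\` [set r])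
| T_within K r C s h D C' s' h' D' :
    tstep (K `\` [set r]) C s h D C' s' h' D' ->
    tstep K (Within r C) s h D (Within r C') s' h' D'
| T_within_skip K r s h D :
    tstep K (Within r Skip) s h D Skip s h (D `|` [set r])
| T_basic K c s h D s' h' : bexec c (s, h) (s', h') ->
    tstep K (Basic c) s h D Skip s' h' D.

(** [Step_WA2] has no counterpart: its premise fails whenever all locked resources of the command
    belong to the held set O. *)
Inductive tabort : set Res -> cmd -> store -> heap -> set Res -> Prop :=
| TA_res_clash K r C s h D : K r -> tabort K (Resource r C) s h D
| TA_with K r B C s h D : ~ K r -> tabort K (With r B C) s h D
| TA_res K r C s h D :
    tabort (K `|` [set r]) C s h (open_res r C D) ->
    tabort K (Resource r C) s h D
| TA_basic K c s h D : babort c s h -> tabort K (Basic c) s h D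
| TA_seq K C1 C2 s h D : tabort K C1 s h D -> tabort K (Seq C1 C2) s h D
| TA_within K r C s h D :
    tabort (K `\` [set r]) C s h D -> tabort K (Within r C) s h D
| TA_par1 K C1 C2 s h D : tabort K C1 s h D -> tabort K (Par C1 C2) s h D
| TA_par2 K C1 C2 s h D : tabort K C2 s h D -> tabort K (Par C1 C2) s h D.

(** The lock discipline of commands reachable from unextended ones: [Within] occurs only where
    execution is in progress, and no resource is held twice. *)
Fixpoint lock_wf C : Prop :=
  match C with
  | Skip | Basic _ => True
  | Seq C1 C2 => lock_wf C1 /\ unextended C2
  | If _ C1 C2 => unextended C1 /\ unextended C2
  | While _ C1 | With _ _ C1 => unextended C1
  | Par C1 C2 =>
      [/\ lock_wf C1, lock_wf C2 & forall q, locked C1 q -> ~ locked C2 q]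
  | Resource _ C1 => lock_wf C1
  | Within r C1 => lock_wf C1 /\ ~ locked C1 r
  end.

Lemma unextended_locked C q : unextended C -> ~ locked C q.
Proof.
elim: C => [|c|C1 IH1 C2 IH2|B C1 _ C2 _|B C1 _|r C1 IH|r B C1 _|C1 IH1 C2 IH2
  |r C1 _] //=; try by move=> _ [].
- by move=> /andP[/IH1].
- by move=> /IH H [/H].
- by move=> /andP[/IH1 H1 /IH2 H2] [/H1|/H2].
Qed.

Lemma unextended_wf C : unextended C -> lock_wf C.
Proof.
elim: C => //= [C1 IH1 C2 IH2|B C1 IH1 C2 IH2|C1 IH1 C2 IH2] /andP[u1 u2].
- by split=> //; apply: IH1.
- by [].
- by split; [exact: IH1|exact: IH2|move=> q /(unextended_locked u1)].
Qed.

(** Only entering or leaving a critical region moves a resource, from [D] to the locked ones or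
    back. The bound by [K] matters at a block: its name is outside [K], hence not in the outer
    [D]. *)
Lemma tstep_locks K C s h D C' s' h' D' :
  tstep K C s h D C' s' h' D' -> lock_wf C ->
  (forall q, D q \/ locked C q -> K q) -> (forall q, D q -> ~ locked C q) ->
  [/\ lock_wf C', forall q, D' q \/ locked C' q <-> D q \/ locked C q
    & forall q, D' q -> ~ locked C' q].
Proof.
elim=> {K C s h D C' s' h' D'}.
- move=> K C2 s h D [_ u] _ _; have nl q := @unextended_locked C2 q u.
  split; [exact: unextended_wf|move=> q; have := nl q|by move=> q _; apply: nl].
  by rewrite /= /set0 /=; tauto.
- move=> K C1 C1' C2 s h D s' h' D' _ IH [/= w1 u2] KD dis.
  by have [w' e' d'] := IH w1 KD dis.
- move=> K B C s h D /= u _ _; split=> [|q|q _ []] //=; by rewrite u.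
- move=> K B C1 C2 s h D /= [u1 u2] _ _.
  have u : unextended (if beval s B then C1 else C2) by case: ifP.
  have nl q := @unextended_locked _ q u.
  split; [exact: unextended_wf|move=> q; have := nl q|by move=> q _; apply: nl].
  by rewrite /set0 /=; tauto.
- move=> K C1 C1' C2 s h D s' h' D' _ IH [/= w1 w2 d12] KD dis.
  have [q Hq|q Dq l1|w' e' d'] := IH w1.
  + by apply: KD; tauto.
  + by apply: (dis q) => //; left.
  + split; first split=> //.
    * by move=> q l1' l2; case: (e' q) => /(_ (or_intror l1')) [Dq _|l1 _];
        [apply: (dis q) => //; right | exact: d12 l1 l2].
    * by move=> q; have := e' q; rewrite /setU /=; tauto.
    * move=> q D'q [|l2]; first exact: d'.
      case: (e' q) => /(_ (or_introl D'q)) [Dq _|l1 _].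
        by apply: (dis q) => //; right.
      exact: d12 l1 l2.
- move=> K C1 C2 C2' s h D s' h' D' _ IH [/= w1 w2 d12] KD dis.
  have [q Hq|q Dq l1|w' e' d'] := IH w2.
  + by apply: KD; tauto.
  + by apply: (dis q) => //; right.
  + split; first split=> //.
    * by move=> q l1 l2'; case: (e' q) => /(_ (or_intror l2')) [Dq _|l2 _];
        [apply: (dis q) => //; left | exact: d12 l1 l2].
    * by move=> q; have := e' q; rewrite /setU /=; tauto.
    * move=> q D'q [l1|]; last exact: d'.
      case: (e' q) => /(_ (or_introl D'q)) [Dq _|l2 _].
        by apply: (dis q) => //; left.
      exact: d12 l1 l2.
- move=> K s h D _ _ _; split=> // q; rewrite /= /setU /=; tauto.
- move=> K r s h D _ _ _ _; split=> // q; rewrite /= /setD /=; tauto.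
- move=> K r C s h D C' s' h' D' nK _ IH /= w KD dis.
  have [q|q|w' e' d'] := IH w.
  + have := KD q; case: (pselect (q = r)) => [->|];
      rewrite /open_res /setU /setD /=; tauto.
  + have := dis q; case: (pselect (q = r)) => [->|];
      rewrite /open_res /setU /setD /=.
      by have := KD r; tauto.
    tauto.
  + split=> //.
    * move=> q; have := e' q; have := KD q.
      case: (pselect (q = r)) => [->|]; rewrite /open_res /setU /setD /=; tauto.
    * by move=> q [/d' nl _] [].
- move=> K r B C s h D Dr _ /= u KD dis.
  have nl q := @unextended_locked _ q u.
  split; first by split; [exact: unextended_wf|].
  + move=> q; have := nl q; case: (pselect (q = r)) => [->|];
      rewrite /setU /setD /=; tauto.
  + move=> q; have := nl q; rewrite /setU /setD /=; tauto.
- move=> K r C s h D C' s' h' D' _ IH /= [w nl] KD dis.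
  have [q|q|w' e' d'] := IH w.
  + have := KD q; have := dis q.
    case: (pselect (q = r)) => [->|]; rewrite /setU /setD /=; tauto.
  + have := dis q; rewrite /setU /=; tauto.
  + have nr : ~ (D' r \/ locked C' r).
      by move/e' => [/dis|//]; apply; right.
    split; first by split=> // l; apply: nr; right.
    * by move=> q; have := e' q; rewrite /setU /=; tauto.
    * move=> q D'q [/(d' _ D'q) //|/= qr]; apply: nr; left; by rewrite -qr.
- move=> K r s h D _ KD dis; split=> // q; rewrite /setU /=; tauto.
- by [].
Qed.

Lemma tstep_mod K C s h D C' s' h' D' : tstep K C s h D C' s' h' D' ->
  mod_cmd C' `<=` mod_cmd C /\ agree (~` mod_cmd C) s s'.
Proof.
elim=> {K C s h D C' s' h' D'} //=.
- move=> K C1 C1' C2 s h D s' h' D' _ [m a]; split.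
    by move=> x [/m|]; [left|right].
  by apply: agree_sub a => x; apply: contra_not; left.
- by move=> *; split=> // x [[]|].
- by move=> K B C1 C2 s *; split=> // x; case: ifP; [left|right].
- move=> K C1 C1' C2 s h D s' h' D' _ [m a]; split.
    by move=> x [/m|]; [left|right].
  by apply: agree_sub a => x; apply: contra_not; left.
- move=> K C1 C2 C2' s h D s' h' D' _ [m a]; split.
    by move=> x [|/m]; [left|right].
  by apply: agree_sub a => x; apply: contra_not; right.
all: move=> *; split=> //; apply: bexec_mod; eassumption.
Qed.

(** * Correspondence with the original transitions *)

Definition names (rho : @rconf Res) : set Res := [set q | in_rconf q rho].

Lemma namesE (rho : @rconf Res) q :
  names rho q <-> rO rho q \/ rL rho q \/ rD rho q.
Proof.
by split=> [[]|[|[]]]; [left|right; left|right; right|constructor 1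
  |constructor 2|constructor 3].
Qed.

Lemma disj3E (O L D : set Res) q : disj3 O L D ->
  [/\ O q -> ~ L q, O q -> ~ D q & L q -> ~ D q].
Proof.
move=> [OL OD LD]; split=> a b.
- by have : set0 q by rewrite -OL.
- by have : set0 q by rewrite -OD.
- by have : set0 q by rewrite -LD.
Qed.

Lemma adjoin_del K r : ~ K r -> (K `|` [set r]) `\` [set r] = K.
Proof.
move=> nr; apply/predeqP => q; rewrite /setU /setD /=.
by split=> [[[]]|Kq] //; split; [left|move=> qr; apply: nr; rewrite -qr].
Qed.

Lemma del_adjoin K r : K r -> (K `\` [set r]) `|` [set r] = K.
Proof.
move=> Kr; apply/predeqP => q; rewrite /setU /setD /=.
by split=> [[[]|->]|Kq] //; case: (pselect (q = r)) => ?; [right|left].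
Qed.

Lemma names_addO (O L D : set Res) r (H : disj3 O L D)
    (H1 : disj3 (O `|` [set r]) L D) :
  names (RConf H1) = names (RConf H) `|` [set r].
Proof.
by apply/predeqP => q; rewrite namesE /setU /= namesE /=; tauto.
Qed.

Lemma names_addD (O L D : set Res) r (H : disj3 O L D)
    (H1 : disj3 O L (D `|` [set r])) :
  names (RConf H1) = names (RConf H) `|` [set r].
Proof.
by apply/predeqP => q; rewrite namesE /setU /= namesE /=; tauto.
Qed.

Lemma names_del r (rho : @rconf Res) :
  names (rconf_del r rho) = names rho `\` [set r].
Proof.
by apply/predeqP => q; rewrite namesE /setD /= namesE; tauto.
Qed.

Lemma names_delO (O L D : set Res) r (H : disj3 O L D)
    (H1 : disj3 (O `\` [set r]) L D) : O r ->
  names (RConf H1) = names (RConf H) `\` [set r].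
Proof.
move=> Or; have [nL nD _] := disj3E r H.
apply/predeqP => q; rewrite namesE /setD /= namesE /=.
by case: (pselect (q = r)) => [->|]; tauto.
Qed.

Lemma open_res_locked r C D : locked C r -> open_res r C D = D.
Proof. by move=> lr; apply/predeqP => q; rewrite /open_res /=; tauto. Qed.

Lemma open_res_unlocked r C D : ~ locked C r -> open_res r C D = D `|` [set r].
Proof. by move=> lr; apply/predeqP => q; rewrite /open_res /setU /=; tauto. Qed.

(** Inside a parallel composition O also contains what the other thread holds, so equality of O with
    the locked set cannot pass through the induction. Instead the locked set is included in O, and a
    step leaves the rest of O as it was. *)
Lemma pstep_tstep c c' : @pstep Var Res Val Loc c c' ->
  match c with
  | Abort => True
  | Run C sg =>
    lock_wf C -> locked C `<=` rO sg.2 ->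
    match c' with
    | Abort => tabort (names sg.2) C sg.1.1 sg.1.2 (rD sg.2)
    | Run C' sg' =>
      [/\ tstep (names sg.2) C sg.1.1 sg.1.2 (rD sg.2)
                C' sg'.1.1 sg'.1.2 (rD sg'.2),
          names sg'.2 = names sg.2
        & forall q, rO sg'.2 q <-> locked C' q \/ (rO sg.2 q /\ ~ locked C q)]
    end
  end.
Proof.
elim=> {c c'}.
- move=> C2 sg [_ u] /= _; split=> //; first exact: T_seq_skip.
  move=> q; have := @unextended_locked _ q u; tauto.
- move=> C1 C1' C2 sg sg' _ IH [/= w1 u2] sub.
  by have [st e o] := IH w1 sub; split=> //; exact: T_seq.
- move=> B C sg /= u _; have nl := fun q => @unextended_locked _ q u.
  split=> //; first exact: T_while.
  by move=> q; rewrite /= /set0 /=; tauto.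
- move=> B C1 C2 s h rho b [/= u1 u2] _; have :=
    T_if (names rho) B C1 C2 s h (rD rho).
  rewrite b => T; split=> // q; have := @unextended_locked _ q u1;
    rewrite /set0 /=; tauto.
- move=> B C1 C2 s h rho b [/= u1 u2] _; have :=
    T_if (names rho) B C1 C2 s h (rD rho).
  rewrite b => T; split=> // q; have := @unextended_locked _ q u2;
    rewrite /set0 /=; tauto.
- move=> C1 C1' C2 sg sg' _ IH [/= w1 w2 d12] sub.
  have [|st e o] := IH w1; first by move=> q Hq; apply: sub; left.
  split=> //; first exact: T_par1.
  move=> q; have := o q; have := d12 q; have := sub q; rewrite /setU /=.
  by case: (pselect (locked C2 q)); tauto.
- move=> C1 C2 C2' sg sg' _ IH [/= w1 w2 d12] sub.
  have [|st e o] := IH w2; first by move=> q Hq; apply: sub; right.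
  split=> //; first exact: T_par2.
  move=> q; have := o q; have := d12 q; have := sub q; rewrite /setU /=.
  by case: (pselect (locked C1 q)); tauto.
- move=> sg _ _; split=> //; first exact: T_par_skip.
  by move=> q; rewrite /= /setU /set0 /=; tauto.
- move=> r s h rho nr _ _; split=> //; first exact: T_res_skip.
  by move=> q; rewrite /= /setD /set0 /=; tauto.
- move=> r C C' s h s' h' O L D H H1 rho' nr lr _ IH /= w sub.
  have [q Hq|] := IH w.
    by case: (pselect (q = r)) => [->|qr]; [right|left; apply: sub].
  rewrite (names_addO H) /= => st e o; have nr' : ~ names (RConf H) r by [].
  split.
  + by apply: T_res; rewrite ?open_res_locked.
  + by rewrite names_del e adjoin_del.
  + move=> q; have := o q; have := nr'; rewrite namesE /= /setU /setD /=.
    by case: (pselect (q = r)) => [->|]; tauto.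
- move=> r C C' s h s' h' O L D H H1 rho' nr lr _ IH /= w sub.
  have [q Hq|] := IH w.
    by apply: sub; split=> // qr; apply: lr; rewrite -qr.
  rewrite (names_addD H) /= => st e o; have nr' : ~ names (RConf H) r by [].
  split.
  + by apply: T_res; rewrite ?open_res_unlocked.
  + by rewrite names_del e adjoin_del.
  + move=> q; have := o q; have := nr'; rewrite namesE /= /setU /setD /=.
    by case: (pselect (q = r)) => [->|]; tauto.
- move=> r B C s h O L D H H1 b /= u _.
  have nl := fun q => @unextended_locked _ q u.
  split.
  + have :=
      @T_with (names (RConf H)) r B C s h (D `|` [set r]) (or_intror erefl) b.
    by rewrite adjoin_del //; have [_ + _] := disj3E r H1; apply; right.
  + by apply/predeqP => q; rewrite !namesE /= /setU /=; tauto.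
  + by move=> q; have := nl q; rewrite /= /setU /set0 /=; tauto.
- move=> r C C' s h s' h' O L D O' L' D' H H1 H2 H3 Or _ IH /= [w nl] sub.
  have [q Hq|] := IH w.
    split=> [|qr]; first by apply: sub; left.
    by apply: nl; rewrite -qr.
  rewrite (names_delO H) //= => st e o; split; first exact: T_within.
  + by rewrite (names_addO H2) e del_adjoin //; constructor 1.
  (* [Step_W1] does not state that the body leaves [r] out of [O']; this follows from the preserved
     set of names, from which [r] was deleted. *)
  + have nr : ~ O' r.
      move=> O'r; have : names (RConf H2) r by constructor 1.
      by rewrite e => -[_ []].
    move=> q; have := o q; rewrite /setU /setD /=.
    by case: (pselect (q = r)) => [->|]; tauto.
- move=> r s h O L D H H1 _ _ /=; have [_ d _] := disj3E r H1; split.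
  + exact: T_within_skip.
  + by apply/predeqP => q; rewrite !namesE /= /setU /=; tauto.
  + move=> q; move: d; rewrite /= /setU /set0 /=.
    by case: (pselect (q = r)) => [->|]; tauto.
- move=> c s h s' h' rho X _ _; split=> //; first exact: T_basic.
  by move=> q; rewrite /= /set0 /=; tauto.
- by move=> r C s h rho nr _ _; exact: TA_res_clash.
- by move=> r B C s h rho nr _ _; exact: TA_with.
- move=> r C s h O L D H H1 lr _ IH /= w sub; apply: TA_res.
  have : tabort (names (RConf H1)) C s h D.
    apply: IH w _ => q Hq.
    by case: (pselect (q = r)) => [->|qr]; [right|left; apply: sub].
  by rewrite (names_addO H) open_res_locked.
- move=> r C s h O L D H H1 lr _ IH /= w sub; apply: TA_res.
  have : tabort (names (RConf H1)) C s h (D `|` [set r]).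
    apply: IH w _ => q Hq.
    by apply: sub; split=> // qr; apply: lr; rewrite -qr.
  by rewrite (names_addD H) open_res_unlocked.
- by move=> c s h rho ab _ _; exact: TA_basic.
- by move=> C1 C2 sg _ IH [/= w _] sub; apply: TA_seq; exact: IH.
- move=> r C s h [O L D H] _ IH /= [w nl] sub.
  have Or : O r by apply: sub; right.
  have : tabort (names (rconf_del r (RConf H))) C s h (D `\` [set r]).
    apply: IH w _ => q Hq; split; first by apply: sub; left.
    by move=> qr; apply: nl; rewrite -qr.
  rewrite names_del; have -> : D `\` [set r] = D; last exact: TA_within.
  have [_ nD _] := disj3E r H; apply/predeqP => q; rewrite /setD /=.
  by case: (pselect (q = r)) => [->|]; tauto.
- move=> r C s h O L D H nO /= _ sub; case: nO; apply: sub; right; exact: erefl.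
- move=> C1 C2 sg _ IH [/= w _ _] sub; apply: TA_par1; apply: IH w _ => q Hq.
  by apply: sub; left.
- move=> C1 C2 sg _ IH [/= _ w _] sub; apply: TA_par2; apply: IH w _ => q Hq.
  by apply: sub; right.
Qed.

End LockFreeSemantics.

(** * Resource invariants *)

Section Invariants.
Context {Var Res : eqType} {Val : valueType} {Loc : pred nat}.
Notation store := (store Var Val).
Notation heap := (heap Val Loc).
Notation rctx := (rctx Var Res).
Implicit Types (s : store) (h : heap) (D L : set Res) (G : rctx).

(** Taken at the locked set, these are variables that a command may rely on; taken at its
    complement, variables that it must leave alone. *)
Definition pv_of G L : set Var :=
  [set x | exists2 E, List.In E G & L (rname E) /\ rvars E x].

Definition avail G D : assn Var := inv_ctx [seq E <- G | `[< D (rname E) >]].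

Lemma In_cat T (x : T) (l1 l2 : seq T) :
  List.In x (l1 ++ l2) <-> List.In x l1 \/ List.In x l2.
Proof. by elim: l1 => /= [|y l1 IH]; [tauto|rewrite IH; tauto]. Qed.

Lemma In_insert T (x y : T) (l1 l2 : seq T) :
  List.In x (l1 ++ y :: l2) <-> y = x \/ List.In x (l1 ++ l2).
Proof. by rewrite !In_cat /=; tauto. Qed.

Lemma In_res_ctx (E : rentry Var Res) G : List.In E G -> res_ctx G (rname E).
Proof.
rewrite /res_ctx /=; elim: G => //= E' G IH [->|/IH]; rewrite inE ?eqxx //.
by move=> ->; rewrite orbT.
Qed.

Lemma res_ctx_insert G1 G2 r (X : set Var) (R : assn Var) :
  res_ctx (G1 ++ REntry r X R :: G2) = res_ctx (G1 ++ G2) `|` [set r].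
Proof.
apply/predeqP => q; rewrite /res_ctx /setU /= !map_cat !mem_cat /= inE.
split=> [/or3P[->|/eqP ->|->]|[/orP[]->|->]]; rewrite ?orbT ?eqxx /= ?orbT;
  by auto.
Qed.

Lemma rctx_insert G1 G2 r (X : set Var) (R : assn Var) :
  is_rctx Val Loc (G1 ++ REntry r X R :: G2) ->
  [/\ is_rctx Val Loc (G1 ++ G2), ~ res_ctx (G1 ++ G2) r,
      precise Val Loc R & fv_assn R `<=` X].
Proof.
move=> [u ok]; split.
- split=> [|E HE]; last by apply/ok/In_insert; right.
  move: u; rewrite !map_cat /= -cat_rcons -!cats1 -catA /=.
  by rewrite (uniq_catCA [seq rname i | i <- G1] [:: r]) /= => /andP[].
- move: u; rewrite /res_ctx /= !map_cat /=.
  by rewrite (uniq_catCA [seq rname i | i <- G1] [:: r]) /= => /andP[/negP].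
- by have /In_insert /ok [] : REntry r X R = REntry r X R \/
    List.In (REntry r X R) (G1 ++ G2) by left.
- by have /In_insert /ok [] : REntry r X R = REntry r X R \/
    List.In (REntry r X R) (G1 ++ G2) by left.
Qed.

Lemma pv_of_insert G1 G2 r X (R : assn Var) L x :
  pv_of (G1 ++ REntry r X R :: G2) L x <->
  (L r /\ X x) \/ pv_of (G1 ++ G2) L x.
Proof.
split=> [[E /In_insert [<-|HE] [/= lr Xx]]|[[lr Xx]|[E HE HL]]].
- by left.
- by right; exists E.
- by exists (REntry r X R) => //; apply/In_insert; left.
- by exists E => //; apply/In_insert; right.
Qed.

Lemma pv_of_sub G L L' : L `<=` L' -> pv_of G L `<=` pv_of G L'.
Proof. by move=> LL x [E HE [/LL ? ?]]; exists E. Qed.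

Lemma avail_agree G D s s' h :
  (forall E, List.In E G -> fv_assn (rinv E) `<=` rvars E) ->
  agree (pv_of G D) s s' -> sat s h (avail G D) -> sat s' h (avail G D).
Proof.
move=> fv a; apply: sat_agree; apply: agree_sub a; rewrite /avail.
elim: G fv => [|E G IH] fv /=; first by [].
have {}IH : fv_assn (avail G D) `<=` pv_of G D.
  by apply: IH => E' HE'; apply: fv; right.
have sub : pv_of G D `<=` pv_of (E :: G) D.
  by move=> x [E' HE' HD]; exists E' => //; right.
case: asboolP => DE x /=; last by move/IH/sub.
case=> [Ex|/IH/sub //]; exists E; first by left.
by split=> //; apply: fv Ex; left.
Qed.

Lemma subheap_hsum (a b c h : heap) :
  hsum a b c -> subheap c h -> subheap a h /\ subheap b h.
Proof.
move=> Hc sub; split=> l lh.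
  have la := hsum_subheap Hc lh; rewrite -la; apply: sub.
  by case: Hc => _ ->; rewrite domf_cat inE lh.
have lb := hsum_subheap (hsumC Hc) lh; rewrite -lb; apply: sub.
by case: Hc => _ ->; rewrite domf_cat inE lh orbT.
Qed.

(** Separating conjunction keeps preciseness: each component is determined among the subheaps of
    [h], hence so is their union. *)
Lemma avail_precise G D : (forall E, List.In E G -> precise Val Loc (rinv E)) ->
  precise Val Loc (avail G D).
Proof.
rewrite /avail; elim: G => [|E G IH] pr /=; first by move=> s h h1 h2 _ _ -> ->.
have {}IH : precise Val Loc (avail G D).
  by apply: IH => E' HE'; apply: pr; right.
case: asboolP => // DE s h h1 h2 S1 S2 /satE_star [a1 [b1 [H1 Ha1 Hb1]]].
move=> /satE_star [a2 [b2 [H2 Ha2 Hb2]]].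
have [Sa1 Sb1] := subheap_hsum H1 S1; have [Sa2 Sb2] := subheap_hsum H2 S2.
have prE : precise Val Loc (rinv E) by apply: pr; left.
have ea := prE _ _ _ _ Sa1 Sa2 Ha1 Ha2; have eb := IH _ _ _ _ Sb1 Sb2 Hb1 Hb2.
by subst; apply: hsum_fun H1 H2.
Qed.

Lemma sat_inv_insert s h G1 G2 (E : rentry Var Res) :
  sat s h (inv_ctx (G1 ++ E :: G2)) <->
    sat s h (AStar (rinv E) (inv_ctx (G1 ++ G2))).
Proof.
elim: G1 h => [//|E' G1 IH] h; rewrite cat_cons [inv_ctx _]/=.
split=> /satE_star [a [b [Hab Ha]]].
- move=> /IH /satE_star [c [d [Hcd Hc Hd]]].
  have [e He Hce] := hsumCA Hab Hcd; apply/satE_star; exists c, e; split=> //.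
  by apply/satE_star; exists a, d.
- move=> /satE_star [c [d [Hcd Hc Hd]]].
  have [e He Hce] := hsumCA Hab Hcd; apply/satE_star; exists c, e; split=> //.
  by apply/IH/satE_star; exists a, d.
Qed.

Lemma avail_insert s h G1 G2 r X R D : D r ->
  sat s h (avail (G1 ++ REntry r X R :: G2) D) <->
  exists h1 h2, [/\ hsum h1 h2 h, sat s h1 R & sat s h2 (avail (G1 ++ G2) D)].
Proof.
move=> Dr; rewrite /avail !filter_cat /=; case: asboolP => // _.
by rewrite sat_inv_insert satE_star.
Qed.

Lemma avail_skip G1 G2 r X R D : ~ D r ->
  avail (G1 ++ REntry r X R :: G2) D = avail (G1 ++ G2) D.
Proof. by move=> Dr; rewrite /avail !filter_cat /=; case: asboolP. Qed.

Lemma eq_avail G D D' : (forall q, res_ctx G q -> D q <-> D' q) ->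
  avail G D = avail G D'.
Proof.
move=> DD; congr inv_ctx.
have {}DD E : List.In E G -> D (rname E) <-> D' (rname E).
  by move=> /In_res_ctx /DD.
elim: G DD => //= E G IH DD; rewrite IH; last by move=> E' HE; apply: DD; right.
have e : D (rname E) <-> D' (rname E) by apply: DD; left.
by case: asboolP; case: asboolP => //; tauto.
Qed.

Lemma avail_all G : avail G (res_ctx G) = inv_ctx G.
Proof.
rewrite (_ : avail _ _ = avail G setT); last by apply: eq_avail.
rewrite /avail (eq_filter (a2 := predT)) ?filter_predT // => E.
by apply/asboolP.
Qed.

Lemma avail0 G : avail G set0 = AEmp.
Proof.
rewrite /avail (eq_filter (a2 := pred0)) ?filter_pred0 // => E.
by apply/negbTE/asboolP.
Qed.

End Invariants.

(** * Safety *)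

Ltac name_step C T := match goal with
  | X : tstep _ C _ _ _ _ _ _ _ |- _ => rename X into T
  | X : tabort _ C _ _ _ |- _ => rename X into T
  end.

Section Safety.
Context {Var Res : eqType} {Val : valueType} {Loc : pred nat}.
Notation store := (store Var Val).
Notation heap := (heap Val Loc).
Notation rctx := (rctx Var Res).
Notation cmd := (cmd Var Res).
Implicit Types (s : store) (h : heap) (D L : set Res) (G : rctx) (C : cmd)
  (A X : set Var) (P Q R : assn Var) (B : bexp Var) (n m : nat).

(** Resources of [G] that are neither in [D] nor locked by [C] count as held by the environment;
    their invariants may be anywhere in [hF], or broken. *)
Definition framed G C s h D hD hF H : Prop :=
  [/\ D `<=` res_ctx G, forall q, D q -> ~ locked C q,
      sat s hD (avail G D) & hsum3 h hD hF H].

(* h is the part of the heap owned by C, hD satisfies the invariants of the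
   available resources D, and hF is owned by the environment.  Before every step
   the environment may change D, hD, hF and all variables that are neither in
   the rely-set nor protected by a resource held by C. *)
Fixpoint safe n G A C Q s h : Prop :=
  if n is n'.+1 then
    forall s1, agree (A `|` pv_of G (locked C)) s s1 ->
    [/\ C = Skip -> sat s1 h Q,
        forall D hD hF H, framed G C s1 h D hD hF H ->
          ~ tabort (res_ctx G) C s1 H D
      & forall D hD hF H C' s' H' D', framed G C s1 h D hD hF H ->
          tstep (res_ctx G) C s1 H D C' s' H' D' ->
          agree (pv_of G (~` locked C)) s1 s' /\
          exists h' hD', [/\ hsum3 h' hD' hF H', sat s' hD' (avail G D')
                          & safe n' G A C' Q s' h']]
  else True.

(** The environment move that opens every step absorbs the change, since agreement composes. *)
Lemma safe_env n G A C Q s s' h :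
  agree (A `|` pv_of G (locked C)) s s' ->
  safe n G A C Q s h -> safe n G A C Q s' h.
Proof.
by case: n => //= n a sf s1 a1; apply: sf; apply: agree_trans a a1.
Qed.

Lemma safeS n G A C Q s h : safe n.+1 G A C Q s h -> safe n G A C Q s h.
Proof.
elim: n C s h => // n IH C s h sf s1 /sf [sk nab st]; split=> //.
move=> D hD hF H C' s' H' D' fr /(st _ _ _ _ _ _ _ _ fr) [g [h' [hD' [? ? ?]]]].
by split=> //; exists h', hD'; split=> //; apply: IH.
Qed.

Lemma safe_le m n G A C Q s h :
  m <= n -> safe n G A C Q s h -> safe m G A C Q s h.
Proof.
move=> /subnK <-; elim: (n - m) => // k IH; rewrite addSn => /safeS; exact: IH.
Qed.

Lemma safe_conseq n G A A' C Q Q' s h : A `<=` A' -> entails Val Loc Q Q' ->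
  safe n G A C Q s h -> safe n G A' C Q' s h.
Proof.
move=> AA QQ; elim: n C s h => // n IH C s h sf s1 a.
have [|sk nab st] := sf s1; first by apply: agree_sub a; exact: setSU.
split=> // [/sk /QQ //|D hD hF H C' s' H' D' fr].
move=> /(st _ _ _ _ _ _ _ _ fr) [g [h' [hD' [? ? ?]]]].
by split=> //; exists h', hD'; split=> //; apply: IH.
Qed.

(** * Sequential commands and structural rules *)

Lemma safe_skip n G A Q s h : fv_assn Q `<=` A -> sat s h Q ->
  safe n G A Skip Q s h.
Proof.
case: n => // n QA HQ s1 a; split=>
  [_|D hD hF H _ ab|D hD hF H C' s' H' D' _ st].
- by apply: sat_agree HQ; apply: agree_sub a => x /QA; left.
- by inversion ab.
- by inversion st.
Qed.

Lemma agreeUl (X Y : set Var) s s' : agree (X `|` Y) s s' -> agree X s s'.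
Proof. by apply: agree_sub; exact: subsetUl. Qed.

(** The heaps [hD] and [hF] together are the frame of the local triple. Since [c] writes no
    protected variable, [hD] satisfies the invariants in the new store too. *)
Lemma safe_basic n G A P c Q s h : is_rctx Val Loc G ->
  fv_assn P `<=` A -> fv_assn Q `<=` A ->
  sl Val Loc P c Q -> mod_bcmd c `&` pv_ctx G = set0 -> sat s h P ->
  safe n G A (Basic c) Q s h.
Proof.
move=> [_ okG] PA QA /sl_sound tr md HP; case: n => // n s1 a.
have {}HP : sat s1 h P.
  by apply: sat_agree HP; apply: agree_sub (agreeUl a).
split=> // [D hD hF H [_ _ _ [g Hg HH]] ab|].
  have [k Hk HHk] := hsumA Hg HH.
  by have [nab _] := tr _ _ _ _ HHk HP; inversion ab.
move=> D hD hF H C' s' H' D' [_ _ HD [g Hg HH]] st; inversion st; subst.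
have Xc : bexec c (s1, H) (s', H') by [].
have [k Hk HHk] := hsumA Hg HH.
have [_ /(_ _ _ Xc) [h' Hh' HQ]] := tr _ _ _ _ HHk HP.
have pv L : agree (pv_of G L) s1 s'.
  apply: agree_sub (bexec_mod Xc) => x [E HE [_ Ex]] mx.
  by have : set0 x by rewrite -md; split=> //; exists E.
split=> //; exists h', hD; split.
- have [e He Hce] := hsumA (hsumC Hk) (hsumC Hh').
  by exists e; exact: hsumC.
- by apply: avail_agree (pv D') HD => E /okG [].
- exact: safe_skip.
Qed.

(** Passing to [C2] costs a step, so safety of [C2] is required only below [n]; this is what lets a
    loop supply its own induction hypothesis here. *)
Lemma safe_seq n G A1 A2 C1 C2 P Q s h : unextended C2 ->
  (forall m s h, m < n -> sat s h P -> safe m G A2 C2 Q s h) ->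
  safe n G A1 C1 P s h -> safe n G (A1 `|` A2) (Seq C1 C2) Q s h.
Proof.
move=> u2; elim: n C1 s h => // n IH C1 s h sf2 sf1 s1 a.
have [|sk nab st] := sf1 s1; first by apply: agree_sub a; exact/setSU/subsetUl.
split=> // [D hD hF H fr ab|D hD hF H C' s' H' D' fr X].
  by inversion ab; subst; apply: nab fr _.
inversion X; subst; last first.
  name_step C1 T; have [g [h' [hD' [? ? sf']]]] := st _ _ _ _ _ _ _ _ fr T.
  split=> //; exists h', hD'; split=> //; apply: IH sf' => m t k mn.
  by apply: sf2; apply: ltnW.
case: fr => _ _ HD HH; split=> //; exists h, hD; split=> //.
by apply: safe_conseq (sf2 _ _ _ (ltnSn n) (sk erefl)) => //; exact: subsetUr.
Qed.

Lemma safe_if n G A1 A2 P B C1 C2 Q s h : fv_assn P `<=` A1 `|` A2 ->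
  (forall m s h, m < n -> sat s h (AAnd P (ABool B)) -> safe m G A1 C1 Q s h) ->
  (forall m s h, m < n -> sat s h (AAnd P (ABool (BNot B))) ->
    safe m G A2 C2 Q s h) ->
  sat s h P -> safe n G (A1 `|` A2) (If B C1 C2) Q s h.
Proof.
case: n => // n PA sf1 sf2 HP s1 a.
have {}HP : sat s1 h P by apply: sat_agree HP; apply: agree_sub (agreeUl a).
split=> // [D hD hF H fr ab|D hD hF H C' s' H' D' [_ _ HD HH] X].
  by inversion ab.
inversion X; subst; split=> //; exists h, hD; split=> //; case: ifP => b.
- by apply: safe_conseq (sf1 _ _ _ (ltnSn n) _) => //; exact: subsetUl.
- have HPn : sat s' h (AAnd P (ABool (BNot B))) by split=> //=; rewrite b.
  by apply: safe_conseq (sf2 _ _ _ (ltnSn n) HPn) => //; exact: subsetUr.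
Qed.

Lemma safe_while n G A P B C s h : fv_assn P `<=` A -> fv_bexp B `<=` A ->
  unextended C ->
  (forall m s h, sat s h (AAnd P (ABool B)) -> safe m G A C P s h) ->
  sat s h P -> safe n G A (While B C) (AAnd P (ABool (BNot B))) s h.
Proof.
(* The loop reappears only after its unfolding, the test and its body, so the index has dropped by
   several units: hence strong induction. *)
move=> PA BA u sf; elim/ltn_ind: n s h => -[//|n] IH s h HP s1 a.
have {}HP : sat s1 h P by apply: sat_agree HP; apply: agree_sub (agreeUl a).
split=> // [D hD hF H fr ab|D hD hF H C' s' H' D' [_ _ HD HH] X].
  by inversion ab.
inversion X; subst; split=> //; exists h, hD; split=> //.
(* Writing [A] as the union of [A] with itself gives the rely-set the shape expected by [safe_if],
   and below by [safe_seq]. *)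
rewrite -(setUid A); apply: (safe_if (P := P)) => //; first by rewrite setUid.
- move=> m t k mn HPB; rewrite -(setUid A); apply: safe_seq (sf _ _ _ HPB) =>
    //.
  by move=> j t' k' jm; apply: IH; apply: ltn_trans jm (ltnW _).
- move=> m t k mn HPB; apply: safe_skip => //=.
  by rewrite subUset.
Qed.

(** During a step [hR] is counted as environment heap. [R] stays true on it because [C] modifies
    none of its variables and the enlarged rely-set forbids the environment to do so. *)
Lemma safe_frame n G A C Q R s h hR k : hsum h hR k ->
  mod_cmd C `&` fv_assn R = set0 -> sat s hR R -> safe n G A C Q s h ->
  safe n G (A `|` fv_assn R) C (AStar Q R) s k.
Proof.
elim: n C s h k => // n IH C s h k Hk md HR sf s1 a.
have {}HR : sat s1 hR R.
  by apply: sat_agree HR; apply: agree_sub (agreeUl a); exact: subsetUr.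
have [|sk nab st] := sf s1; first by apply: agree_sub a; exact/setSU/subsetUl.
have fr' D hD hF H : framed G C s1 k D hD hF H ->
    exists2 hF', hsum hR hF hF' & framed G C s1 h D hD hF' H.
  move=> [? ? ? HH]; have [hF' HF HH'] := hsum3_frame Hk HH.
  by exists hF'.
split=> [/sk HQ|D hD hF H /fr' [hF' _ /nab] //|].
  by apply/satE_star; exists h, hR.
move=> D hD hF H C' s' H' D' /fr' [hF' HF fr] X.
have [g [h' [hD' [HH' HD' sf']]]] := st _ _ _ _ _ _ _ _ fr X.
have [k' Hk' HHk'] := hsum3_unframe HF HH'.
split=> //; exists k', hD'; split=> //.
have [m am] := tstep_mod X.
apply: IH Hk' _ _ sf'.
- by rewrite -subset0 => x [/m ? ?]; rewrite -md.
- apply: sat_agree HR; apply: agree_sub am => x Rx mx.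
  by have : set0 x by rewrite -md.
Qed.

Lemma safe_conj n G A1 A2 C Q1 Q2 s h : is_rctx Val Loc G ->
  safe n G A1 C Q1 s h -> safe n G A2 C Q2 s h ->
  safe n G (A1 `|` A2) C (AAnd Q1 Q2) s h.
Proof.
move=> [_ okG]; elim: n C s h => // n IH C s h sf1 sf2 s1 a.
have [|sk1 nab st1] := sf1 s1; first by apply: agree_sub a;
  exact/setSU/subsetUl.
have [|sk2 _ st2] := sf2 s1; first by apply: agree_sub a; exact/setSU/subsetUr.
split=> // [E|D hD hF H C' s' H' D' fr X]; first by split;
  [exact: sk1|exact: sk2].
have [g [h1 [d1 [[a1 Ha1 HH1] HD1 sf1']]]] := st1 _ _ _ _ _ _ _ _ fr X.
have [_ [h2 [d2 [[a2 Ha2 HH2] HD2 sf2']]]] := st2 _ _ _ _ _ _ _ _ fr X.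
(* Cancelling [hF] shows that both derivations split one and the same heap, so preciseness applies
   to its subheaps [d1] and [d2]. *)
split=> //; have e := hsum_inj HH1 HH2; subst a2.
have ed : d1 = d2.
  have pr : precise Val Loc (avail G D') by apply: avail_precise => E /okG [].
  by apply: pr HD1 HD2;
    [exact: hsum_subheap (hsumC Ha1)|exact: hsum_subheap (hsumC Ha2)].
subst d2; have eh := hsum_inj Ha1 Ha2; subst h2.
by exists h1, d1; split=> //; [exists a1|apply: IH].
Qed.

(** * Parallel composition *)

Lemma safe_par_step n G A1 A2 C1 C2 Q1 Q2 s s1 h h1 h2 D hD hF H C1' s' H' D' :
  safe n.+1 G A1 C1 Q1 s h1 -> safe n.+1 G A2 C2 Q2 s h2 -> hsum h1 h2 h ->
  mod_cmd C1 `&` A2 = set0 -> (forall q, locked C1 q -> ~ locked C2 q) ->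
  agree ((A1 `|` A2) `|` pv_of G (locked C1 `|` locked C2)) s s1 ->
  framed G (Par C1 C2) s1 h D hD hF H ->
  tstep (res_ctx G) C1 s1 H D C1' s' H' D' ->
  agree (pv_of G (~` (locked C1 `|` locked C2))) s1 s' /\
  exists h1' h' hD', [/\ hsum h1' h2 h', hsum3 h' hD' hF H',
    sat s' hD' (avail G D'), safe n G A1 C1' Q1 s' h1' & safe n G A2 C2 Q2 s' h2].
Proof.
move=> sf1 sf2 Hh md d12 a [DK dis HD HH] X.
have [|_ _ st] := sf1 s1.
  apply: agree_sub a => x [|Hx]; first by left; left.
  by right; apply: pv_of_sub Hx; exact: subsetUl.
have [hF' HF HH'] := hsum3_frame Hh HH.
have fr : framed G C1 s1 h1 D hD hF' H.
  by split=> // q Dq l1; apply: (dis q) => //; left.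
have [g [h1' [hD' [HH1 HD' sf1']]]] := st _ _ _ _ _ _ _ _ fr X.
have [h' Hh' HHh'] := hsum3_unframe HF HH1.
split; first by apply: agree_sub g; apply: pv_of_sub => q; apply: contra_not;
  left.
exists h1', h', hD'; split=> //; apply: safe_env (safeS sf2).
apply: (@agree_trans _ _ _ _ s1).
  apply: agree_sub a => x [|Hx]; first by left; right.
  by right; apply: pv_of_sub Hx; exact: subsetUr.
(* The step of [C1] changes nothing that [C2] relies on: [A2] by the side condition on modified
   variables, the variables protected by the locks of [C2] by the guarantee [g], as [C1] holds none
   of these locks. *)
have [_ am] := tstep_mod X; apply: agreeU.
  by apply: agree_sub am => x Ax mx; have : set0 x by rewrite -md.
by apply: agree_sub g; apply: pv_of_sub => q l2 l1; apply: d12 l1 l2.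
Qed.

Definition lock_ok G C : Prop := lock_wf C /\ locked C `<=` res_ctx G.

Lemma framed_step G C s h D hD hF H C' s' H' D' : lock_ok G C ->
  framed G C s h D hD hF H -> tstep (res_ctx G) C s H D C' s' H' D' ->
  [/\ lock_ok G C', forall q, D' q \/ locked C' q <-> D q \/ locked C q
    & forall q, D' q -> ~ locked C' q].
Proof.
move=> [w lK] [DK dis _ _] X.
have KD q : D q \/ locked C q -> res_ctx G q by move=> [/DK|/lK].
have [w' e d'] := tstep_locks X w KD dis.
by split=> //; split=> // q lq; apply/KD/e; right.
Qed.

Lemma safe_par n G A1 A2 C1 C2 Q1 Q2 s h h1 h2 :
  fv_assn Q1 `<=` A1 -> fv_assn Q2 `<=` A2 ->
  lock_ok G (Par C1 C2) ->
  mod_cmd C1 `&` A2 = set0 -> mod_cmd C2 `&` A1 = set0 -> hsum h1 h2 h ->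
  safe n G A1 C1 Q1 s h1 -> safe n G A2 C2 Q2 s h2 ->
  safe n G (A1 `|` A2) (Par C1 C2) (AStar Q1 Q2) s h.
Proof.
move=> QA1 QA2; elim: n C1 C2 s h h1 h2 => // n IH C1 C2 s h h1 h2.
move=> lok md1 md2 Hh sf1 sf2 s1 a; have [[/= w1 w2 d12] lK] := lok.
have [|sk1 nab1 _] := sf1 s1.
  apply: agree_sub a => x [|Hx]; first by left; left.
  by right; apply: pv_of_sub Hx; exact: subsetUl.
have [|sk2 nab2 _] := sf2 s1.
  apply: agree_sub a => x [|Hx]; first by left; right.
  by right; apply: pv_of_sub Hx; exact: subsetUr.
split=> // [D hD hF H [DK dis HD HH] ab|D hD hF H C' s' H' D' fr X].
  inversion ab; subst.
  - name_step C1 T; have [hF' _ HH'] := hsum3_frame Hh HH; apply: nab1 T; split;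
      try eassumption.
    by move=> q Dq l; apply: (dis q) => //; left.
  - name_step C2 T; have [hF' _ HH'] := hsum3_frame (hsumC Hh) HH.
    apply: nab2 T; split; try eassumption.
    by move=> q Dq l; apply: (dis q) => //; right.
have [lok' _ _] := framed_step lok fr X.
inversion X; subst.
- name_step C1 T.
  have [g [h1' [h' [hD' [? ? ? sf1' sf2']]]]] :=
    safe_par_step sf1 sf2 Hh md1 d12 a fr T.
  split=> //; exists h', hD'; split=> //; apply: IH sf1' sf2' => //.
  have [m _] := tstep_mod T.
  by rewrite -subset0 => x [/m ? ?]; rewrite -md1.
- name_step C2 T; have d21 q : locked C2 q -> ~ locked C1 q by move=> l2 /d12.
  have a' : agree ((A2 `|` A1) `|` pv_of G (locked C2 `|` locked C1)) s s1.
    by rewrite (setUC A2) (setUC (locked C2)).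
  have fr' : framed G (Par C2 C1) s1 h D hD hF H.
    case: fr => ? dis ? ?; split=> // q Dq l; apply: (dis q Dq).
    by case: l; [right|left].
  have [g [h2' [h' [hD' [? ? ? sf2' sf1']]]]] :=
    safe_par_step sf2 sf1 (hsumC Hh) md2 d21 a' fr' T.
  split; first by rewrite [locked _]/= setUC.
  exists h', hD'; split=> //; apply: IH sf1' sf2' => //; last exact: hsumC.
  have [m _] := tstep_mod T.
  by rewrite -subset0 => x [/m ? ?]; rewrite -md2.
- case: fr => _ _ HD HH; split=> //; exists h, hD; split=> //.
  apply: safe_skip; last by apply/satE_star; exists h1, h2; split; auto.
  by move=> x [/QA1|/QA2]; [left|right].
Qed.

(** * Critical regions and resource blocks *)

Section Critical.
Variables (G1 G2 : rctx) (r : Res) (X A : set Var) (R : assn Var).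
Hypothesis okG' : is_rctx Val Loc (G1 ++ REntry r X R :: G2).
Notation G := (G1 ++ G2).
Notation G' := (G1 ++ REntry r X R :: G2).

(** While [r] is held, its invariant lies in the heap of the command and [X] is shielded by the
    lock. The body may therefore be run with [X] in its rely-set and without [r] in its context. *)
Lemma safe_within n C Q s h : fv_assn Q `<=` A -> lock_ok G' (Within r C) ->
  safe n G (A `|` X) C (AStar Q R) s h -> safe n G' A (Within r C) Q s h.
Proof.
have [okG nr prR RX] := rctx_insert okG'.
have KE : res_ctx G' `\` [set r] = res_ctx G by rewrite res_ctx_insert adjoin_del.
move=> QA; elim: n C s h => // n IH C s h lok sf s1 a.
have [[w nl] lK] := lok.
have [|sk nab st] := sf s1.
  apply: agree_sub a => x [[Ax|Xx]|[E HE [lE Ex]]]; first by left.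
    by right; apply/pv_of_insert; left; split=> //; right.
  by right; apply/pv_of_insert; right; exists E => //; split=> //; left.
have fr' D hD hF H : framed G' (Within r C) s1 h D hD hF H ->
    framed G C s1 h D hD hF H.
  move=> [DK dis HD HH]; have nD : ~ D r by move=> /dis; apply; right.
  split=> // [q Dq|q Dq l|]; last by rewrite avail_skip in HD.
    by rewrite -KE; split; [exact: DK|move=> qr; apply: nD; rewrite -qr].
  by apply: (dis q) => //; left.
split=> // [D hD hF H fr ab|D hD hF H C' s' H' D' fr T].
  by inversion ab; subst; apply: nab (fr' _ _ _ _ fr) _; rewrite -KE.
have [lok' _ dis'] := framed_step lok fr T.
inversion T; subst.
- name_step C T'; rewrite KE in T'.
  have [g [h' [hD' [HH' HD' sf']]]] := st _ _ _ _ _ _ _ _ (fr' _ _ _ _ fr) T'.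
  split.
    apply: agree_sub g => x /pv_of_insert [[/= nlr]|[E HE [/= nlE Ex]]].
      by case: nlr; right.
    by exists E => //; split=> // l; apply: nlE; left.
  exists h', hD'; split=> //; last exact: IH.
  by rewrite avail_skip // => /dis'; apply; right.
- have nD : ~ D r by case: fr => _ dis _ _ /dis; apply; right.
  have /satE_star [hQ [hR [Hh HQ HR]]] := sk erefl.
  have [_ _ HD HH] := fr' _ _ _ _ fr.
  (* Leaving the region hands [hR] over to the available invariants. *)
  have [hD' HhD HH'] := hsum3_assoc Hh HH.
  split=> //; exists hQ, hD'; split=> //; last exact: safe_skip.
  apply/avail_insert; first by right.
  exists hR, hD; split=> //; rewrite (eq_avail (D' := D)) // => q Gq.
  by split=> [[//|/= qr]|]; [case: nr; rewrite -qr|left].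
Qed.

Lemma safe_with n B C P Q s h : fv_assn P `<=` A -> fv_assn Q `<=` A ->
  unextended C ->
  (forall m s h, sat s h (AStar (AAnd P (ABool B)) R) ->
    safe m G (A `|` X) C (AStar Q R) s h) ->
  sat s h P -> safe n G' A (With r B C) Q s h.
Proof.
have [okG nr prR RX] := rctx_insert okG'.
move=> PA QA u sf HP; case: n => // n s1 a.
have {}HP : sat s1 h P by apply: sat_agree HP; apply: agree_sub (agreeUl a).
have Kr : res_ctx G' r by rewrite res_ctx_insert; right.
split=> // [D hD hF H fr ab|D hD hF H C' s' H' D' fr T].
  by inversion ab; subst; tauto.
have lok : lock_ok G' (With r B C) by split.
have [lok' _ _] := framed_step lok fr T.
inversion T; subst; case: fr => DK _ HD HH; split=> //.
(* Entering the region detaches [hR] from the available invariants and adds it to the heap of the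
   command. *)
have := HD; rewrite avail_insert // => -[hR [hD' [HhD HR HD']]].
have [h' Hh' HH'] := hsum3_unassoc HhD HH.
exists h', hD'; split=> //.
  rewrite avail_skip; last by move=> [_ []].
  rewrite (eq_avail (D' := D)) // => q Gq; split=> [[] //|Dq]; split=> // qr.
  by case: nr; rewrite -qr.
apply: safe_within => //; apply: sf; apply/satE_star; exists h, hR.
by split=> //; split.
Qed.

(** Seen from outside, the block always owns the heap of its private resource. Hence [k] is [h]
    while the body holds [r], with the heap of [R] inside [h] or in use, and [h] plus a heap for [R]
    while [r] is free. *)
Lemma safe_resource n C Q s h k : fv_assn Q `<=` A -> lock_ok G' C ->
  safe n G' A C Q s h ->
  (locked C r -> k = h) ->
  (~ locked C r -> exists2 hR, hsum h hR k & sat s hR R) ->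
  safe n G (A `|` X) (Resource r C) (AStar Q R) s k.
Proof.
have [okG nr prR RX] := rctx_insert okG'.
have KE : res_ctx G `|` [set r] = res_ctx G' by rewrite res_ctx_insert.
move=> QA; elim: n C s h k => // n IH C s h k lok sf kl ku s1 a.
have [|sk nab st] := sf s1.
  apply: agree_sub a => x [Ax|/pv_of_insert [[_ Xx]|[E HE [lE Ex]]]].
  - by left; left.
  - by left; right.
  - right; exists E => //; split=> //; split=> // Er; apply: nr.
    by rewrite -Er; apply: In_res_ctx.
have {}ku : ~ locked C r -> exists2 hR, hsum h hR k & sat s1 hR R.
  move=> /ku [hR Hk HR]; exists hR => //; apply: sat_agree HR.
  by apply: agree_sub (agreeUl a) => x /RX; right.
have fr' D hD hF H : framed G (Resource r C) s1 k D hD hF H ->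
    exists hD1, framed G' C s1 h (open_res r C D) hD1 hF H.
  move=> [DK dis HD HH].
  have nD : ~ D r by move=> /DK.
  case: (pselect (locked C r)) => lr.
    exists hD; rewrite open_res_locked //; rewrite (kl lr) in HH; split=> //.
    - by move=> q /DK ?; rewrite -KE; left.
    - move=> q Dq l; apply: (dis q) => //; split=> // qr; apply: nD.
      by rewrite -qr.
    - by rewrite avail_skip.
  (* With [r] free, the part [hR] owned by the block is presented to the body as one more available
     invariant. *)
  have [hR Hk HR] := ku lr; have [hD1 HhD HH'] := hsum3_assoc Hk HH.
  exists hD1; rewrite open_res_unlocked //; split=> //.
  - by move=> q [/DK ?|->]; rewrite -KE; [left|right].
  - move=> q [Dq l|-> //]; apply: (dis q) => //; split=> // qr; apply: nD.
    by rewrite -qr.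
  - apply/avail_insert; first by right.
    exists hR, hD; split=> //; rewrite (eq_avail (D' := D)) // => q Gq.
    by split=> [[//|/= qr]|]; [case: nr; rewrite -qr|left].
split=> // [D hD hF H /fr' [hD1 fr] ab|D hD hF H C' s' H' D' fr T].
  by inversion ab; subst => //; apply: nab fr _; rewrite -KE.
inversion T; subst.
- have [hR Hk HR] := ku id; case: fr => DK dis HD HH.
  split=> //; exists k, hD; split=> //; apply: safe_skip.
    by move=> x [/QA|/RX]; [left|right].
  by apply/satE_star; exists h, hR; split=> //; apply: sk.
- have [hD1 fr1] := fr' _ _ _ _ fr.
  name_step C T'; rewrite KE in T'.
  have [lok' e' dis'] := framed_step lok fr1 T'.
  have [g [h' [hD1' [HH' HD1' sf']]]] := st _ _ _ _ _ _ _ _ fr1 T'.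
  split.
    apply: agree_sub g => x [E HE [nlE Ex]]; apply/pv_of_insert; right.
    exists E => //; split=> // l; apply: nlE; split=> // Er; apply: nr.
    by rewrite -Er; apply: In_res_ctx.
  have eD D1 : avail G (D1 `\` [set r]) = avail G D1.
    apply: eq_avail => q Gq; split=> [[] //|Dq]; split=> // qr; apply: nr.
    by rewrite -qr.
  (* A step of the body cannot lose [r]: it is afterwards either available or held, and this decides
     which of the two relations between [k] and [h] is re-established. *)
  have D1r : D'0 r \/ locked C'0 r.
    by apply/e'; rewrite /open_res /=; case: (pselect (locked C r)); auto.
  case: (pselect (D'0 r)) => Dr.
    have lr := dis' _ Dr.
    move: HD1'; rewrite avail_insert // => -[hR [hD' [HhD HR HD']]].
    have [k' Hk' HH''] := hsum3_unassoc HhD HH'.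
    exists k', hD'; split=> //; first by rewrite eD.
    by apply: IH lok' sf' _ _ => // _; exists hR.
  exists h', hD1'; split=> //; first by rewrite eD; rewrite avail_skip in HD1'.
  apply: IH lok' sf' _ _ => // nl; by case: D1r.
Qed.

End Critical.

End Safety.

(** * Auxiliary variables *)

Section Auxiliary.
Context {Var Res : eqType} {Val : valueType} {Loc : pred nat}.
Notation store := (store Var Val).
Notation heap := (heap Val Loc).
Notation rctx := (rctx Var Res).
Notation cmd := (cmd Var Res).
Variable X : set Var.
Implicit Types (s t : store) (h : heap) (K D : set Res) (G : rctx) (C : cmd).

Lemma disjoint_agree (Y : set Var) s t :
  Y `&` X = set0 -> agree (~` X) s t -> agree Y s t.
Proof.
by move=> YX; apply: agree_sub => x Yx Xx; have : set0 x by rewrite -YX.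
Qed.

Lemma locked_erase C : locked (erase X C) = locked C.
Proof.
elim: C => //= [c|r C1 -> //|C1 -> C2 -> //|r C1 -> //].
by case: c => //= x e; case: ifP.
Qed.

Lemma unextended_erase C : unextended (erase X C) = unextended C.
Proof.
elim: C => //= [c|C1 -> C2 ->|B C1 -> C2 ->|C1 -> C2 ->] //.
by case: c => //= x e; case: ifP.
Qed.

Lemma erase_skip C : erase X C = Skip ->
  C = Skip \/ exists x e, C = Basic (Assign x e) /\ X x.
Proof.
case: C => //= [|c]; first by left.
by case: c => //= x e; case: asboolP => // Xx _; right; exists x, e.
Qed.

Lemma erase_basic C c : erase X C = Basic c -> auxiliary X C ->
  C = Basic c /\ fv_bcmd c `&` X = set0.
Proof.
case: C => //= c'; case: c' => [x e|x e|e e'|x e es|e] /=;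
  last by move=> [<-].
- case: asboolP => // Xx [<-] [//|eX]; split=> //=.
  by rewrite setIUl eX setU0 -subset0 => y [/= -> ].
- by move=> [<-].
- by move=> [<-].
- by move=> [<-].
Qed.

Lemma auxiliary_tstep K C s h D C' s' h' D' :
  tstep K C s h D C' s' h' D' -> auxiliary X C -> auxiliary X C'.
Proof.
elim=> {K C s h D C' s' h' D'} //=; try tauto.
- by move=> _ B C _ _ _ [].
- by move=> K B C1 C2 s h D [_ a1 a2]; case: ifP.
Qed.

(** Moves of the original command that its erasure does not show, such as an assignment to [X]
    standing where the erased command has [Skip]. They are counted because safety pays one unit for
    each. *)
Inductive ghost_run K D h : nat -> cmd -> store -> cmd -> store -> Prop :=
| Ghost_refl C t : ghost_run K D h 0 C t C t
| Ghost_step k C t C1 t1 C2 t2 :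
    tstep K C t h D C1 t1 h D -> erase X C1 = erase X C ->
    agree (~` X) t t1 -> ghost_run K D h k C1 t1 C2 t2 ->
    ghost_run K D h k.+1 C t C2 t2.

Lemma ghost_trans K D h k1 k2 C t C1 t1 C2 t2 :
  ghost_run K D h k1 C t C1 t1 -> ghost_run K D h k2 C1 t1 C2 t2 ->
  ghost_run K D h (k1 + k2) C t C2 t2.
Proof.
elim=> // k Ca ta Cb tb Cc tc st e a _ IH /IH; exact: Ghost_step st e a.
Qed.

Lemma ghost_agree K D h k C t C1 t1 : ghost_run K D h k C t C1 t1 ->
  [/\ erase X C1 = erase X C, agree (~` X) t t1
    & auxiliary X C -> auxiliary X C1].
Proof.
elim=> // {}k Ca ta Cb tb Cc tc st e a _ [e' a' x]; split=> [|| y].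
- by rewrite e'.
- exact: agree_trans a a'.
- exact/x/(auxiliary_tstep st).
Qed.

(** The restriction to commands with the erasure of [C] serves [Resource]: the set offered to the
    body depends on its locked resources, which the erasure determines. *)
Lemma ghost_cong (f : cmd -> cmd) K K' D D' h k C t C1 t1 :
  (forall C2 t C3 t', erase X C2 = erase X C ->
    tstep K C2 t h D C3 t' h D -> tstep K' (f C2) t h D' (f C3) t' h D') ->
  (forall C2 C3, erase X C2 = erase X C3 -> erase X (f C2) = erase X (f C3)) ->
  ghost_run K D h k C t C1 t1 -> ghost_run K' D' h k (f C) t (f C1) t1.
Proof.
move=> + ef gr; elim: gr => {C t C1 t1}
  [Ca ta _|{}k Ca ta Cb tb Cc tc st e a _ IH stf]; first exact: Ghost_refl.
apply: Ghost_step (ef _ _ e) a _; first exact: stf.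
by apply: IH => C2 t C3 t' e2; apply: stf; rewrite e2.
Qed.

Lemma ghost_skip K D h C t : erase X C = Skip ->
  exists k t1, k <= 1 /\ ghost_run K D h k C t Skip t1.
Proof.
move=> /erase_skip [->|[x [e [-> Xx]]]].
  by exists 0, t; split=> //; exact: Ghost_refl.
exists 1, (upd t x (eval t e)); split=> //.
apply: (Ghost_step _ _ _ (Ghost_refl _ _ _ _ _)).
- exact/T_basic/Bexec_assign.
- by rewrite /=; case: asboolP.
- by apply: agree_upd.
Qed.

Lemma open_resD r C D : ~ D r -> open_res r C D `\` [set r] = D.
Proof.
move=> nD; apply/predeqP => q; rewrite /open_res /setD /=.
by split=> [[[|[]]]|Dq] //; split; [left|move=> qr; apply: nD; rewrite -qr].
Qed.

(** Hidden assignments are run first, then the matching step. The bound 2 is reached when two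
    threads join, since each may still have one assignment to [X] pending. *)
Lemma tstep_erase K C0 s h D C0' s' h' D' :
  tstep K C0 s h D C0' s' h' D' -> forall C t, erase X C = C0 ->
  auxiliary X C -> (forall q, D q -> K q /\ ~ locked C q) ->
  agree (~` X) s t ->
  exists k C1 t1 C' t', [/\ k <= 2, ghost_run K D h k C t C1 t1,
    tstep K C1 t1 h D C' t' h' D', erase X C' = C0' & agree (~` X) s' t'].
Proof.
elim=> {K C0 s h D C0' s' h' D'}.
- move=> K C20 s h D [] // => [c|C1 C2] t; first by case: c => //= x e;
    case: ifP.
  move=> /= [/(ghost_skip K D h t) [k [t1 [k1 gr]]] <-] [aux1 aux2] _ a.
  have [_ a1 _] := ghost_agree gr.
  exists k, (Seq Skip C2), t1, C2, t1; split=> //; first exact: leq_trans k1 _.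
  + apply: (ghost_cong (f := fun C => Seq C C2)) gr => [*|C3 C4 /= -> //].
    exact: T_seq.
  + exact: T_seq_skip.
  + exact: agree_trans a a1.
- move=> K C10 C10' C20 s h D s' h' D' _ IH [] // => [c|C1 C2] t.
    by case: c => //= x e; case: ifP.
  move=> /= [e1 <-] [aux1 aux2] dis a.
  have [k [C3 [t1 [C' [t' [k2 gr st e a']]]]]] := IH _ _ e1 aux1 dis a.
  exists k, (Seq C3 C2), t1, (Seq C' C2), t'; split=> //=.
  + apply: (ghost_cong (f := fun C => Seq C C2)) gr => [*|C5 C4 /= -> //].
    exact: T_seq.
  + exact: T_seq.
  + by rewrite e.
- move=> K B C0 s h D [] // => [c|B' C] t; first by case: c => //= x e;
    case: ifP.
  move=> /= [-> <-] aux dis a.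
  exists 0, (While B C), t, (If B (Seq C (While B C)) Skip), t.
  by split=> //; [exact: Ghost_refl|exact: T_while].
- move=> K B C10 C20 s h D [] // => [c|B' C1 C2] t.
    by case: c => //= x e; case: ifP.
  move=> /= [-> <- <-] [BX _ _] dis a.
  exists 0, (If B C1 C2), t, (if beval t B then C1 else C2), t.
  split=> //; [exact: Ghost_refl|exact: T_if|].
  by rewrite (beval_agree (disjoint_agree BX a)); case: ifP.
- move=> K C10 C10' C20 s h D s' h' D' _ IH [] // => [c|C1 C2] t.
    by case: c => //= x e; case: ifP.
  move=> /= [e1 <-] [aux1 aux2] dis a.
  have [|k [C3 [t1 [C' [t' [k2 gr st e a']]]]]] := IH _ _ e1 aux1 _ a.
    by move=> q /dis [Kq nl]; split=> // l; apply: nl; left.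
  exists k, (Par C3 C2), t1, (Par C' C2), t'; split=> //=.
  + apply: (ghost_cong (f := fun C => Par C C2)) gr => [*|C5 C4 /= -> //].
    exact: T_par1.
  + exact: T_par1.
  + by rewrite e.
- move=> K C10 C20 C20' s h D s' h' D' _ IH [] // => [c|C1 C2] t.
    by case: c => //= x e; case: ifP.
  move=> /= [<- e2] [aux1 aux2] dis a.
  have [|k [C3 [t1 [C' [t' [k2 gr st e a']]]]]] := IH _ _ e2 aux2 _ a.
    by move=> q /dis [Kq nl]; split=> // l; apply: nl; right.
  exists k, (Par C1 C3), t1, (Par C1 C'), t'; split=> //=.
  + apply: (ghost_cong (f := fun C => Par C1 C)) gr => [*|C5 C4 /= -> //].
    exact: T_par2.
  + exact: T_par2.
  + by rewrite e.
- move=> K s h D [] // => [c|C1 C2] t; first by case: c => //= x e; case: ifP.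
  move=> /= [/(ghost_skip K D h t) [k [t1 [k1 gr]]]].
  move=> /(ghost_skip K D h t1) [k' [t2 [k2 gr']]] _ _ a.
  have [_ a1 _] := ghost_agree gr; have [_ a2 _] := ghost_agree gr'.
  exists (k + k'), (Par Skip Skip), t2, Skip, t2; split=> //.
  + exact: (leq_add k1 k2).
  + apply: (@ghost_trans _ _ _ _ _ _ _ (Par Skip C2) t1).
      apply: (ghost_cong (f := fun C => Par C C2)) gr => [*|C5 C4 /= -> //].
      exact: T_par1.
    apply: (ghost_cong (f := fun C => Par Skip C)) gr' => [*|C5 C4 /= -> //].
    exact: T_par2.
  + exact: T_par_skip.
  + exact: agree_trans a (agree_trans a1 a2).
- move=> K r s h D nK [] // => [c|r' C] t; first by case: c => //= x e;
    case: ifP.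
  move=> /= [-> e] aux dis a; have nD : ~ D r by move=> /dis [].
  have [k [t1 [k1 gr]]] := ghost_skip (K `|` [set r]) (open_res r C D) h t e.
  have [_ a1 _] := ghost_agree gr.
  exists k, (Resource r Skip), t1, Skip, t1; split=> //.
  + exact: leq_trans k1 _.
  + apply: (ghost_cong (f := Resource r)) gr => [C2 t2 C3 t3 e2 st|C5 C4 /= ->
      //].
    (* A step of a block returns the available set with [r] deleted; as [r] is not in [D], this is
       [D] again, as a hidden move requires. *)
    rewrite -{2}(open_resD C nD); apply: T_res => //.
    suff -> : open_res r C2 D = open_res r C D by [].
    by rewrite /open_res -(locked_erase C2) e2 locked_erase.
  + exact: T_res_skip.
  + exact: agree_trans a a1.
- move=> K r C0 s h D C0' s' h' D' nK _ IH [] // => [c|r' C] t.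
    by case: c => //= x e; case: ifP.
  move=> /= [-> e0] aux dis a; have nD : ~ D r by move=> /dis [].
  have oE C2 : erase X C2 = C0 -> open_res r C2 D = open_res r C0 D.
    by move=> e2; rewrite /open_res -e2 locked_erase.
  have [|k [C3 [t1 [C' [t' [k2 gr st e a']]]]]] := IH _ _ e0 aux _ a.
    move=> q; rewrite /open_res -e0 locked_erase => -[Dq|[-> nl]].
      have [Kq nl] := dis _ Dq; split; first by left.
      by move=> l; apply: nl; split=> // qr; apply: nD; rewrite -qr.
    by split=> //; right.
  have [e3 _ _] := ghost_agree gr.
  exists k, (Resource r C3), t1, (Resource r C'), t'; split=> //=.
  + apply: (ghost_cong (f := Resource r)) gr => [C2 t2 C4 t4 e2 st2|C5 C4 /= ->
      //].
    rewrite -{2}(open_resD C0 nD); apply: T_res => //.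
    by rewrite oE // e2.
  + by apply: T_res => //; rewrite oE // e3.
  + by rewrite e.
- move=> K r B C0 s h D Dr b [] // => [c|r' B' C] t.
    by case: c => //= x e; case: ifP.
  move=> /= [-> -> <-] [BX _] dis a.
  exists 0, (With r B C), t, (Within r C), t.
  split=> //; [exact: Ghost_refl|apply: T_with => //].
  by rewrite -(beval_agree (disjoint_agree BX a)).
- move=> K r C0 s h D C0' s' h' D' _ IH [] // => [c|r' C] t.
    by case: c => //= x e; case: ifP.
  move=> /= [-> e0] aux dis a.
  have [|k [C3 [t1 [C' [t' [k2 gr st e a']]]]]] := IH _ _ e0 aux _ a.
    move=> q /dis [Kq nl]; split; last by move=> l; apply: nl; left.
    by split=> // qr; apply: nl; right.
  exists k, (Within r C3), t1, (Within r C'), t'; split=> //=.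
  + apply: (ghost_cong (f := Within r)) gr => [*|C5 C4 /= -> //].
    exact: T_within.
  + exact: T_within.
  + by rewrite e.
- move=> K r s h D [] // => [c|r' C] t; first by case: c => //= x e; case: ifP.
  move=> /= [-> e] aux dis a.
  have [k [t1 [k1 gr]]] := ghost_skip (K `\` [set r]) D h t e.
  have [_ a1 _] := ghost_agree gr.
  exists k, (Within r Skip), t1, Skip, t1; split=> //.
  + exact: leq_trans k1 _.
  + apply: (ghost_cong (f := Within r)) gr => [*|C5 C4 /= -> //].
    exact: T_within.
  + exact: T_within_skip.
  + exact: agree_trans a a1.
- move=> K c s h D s' h' ex C t /erase_basic e aux _ a.
  have [-> cX] := e aux.
  have [t' [ext am an]] := bexec_agree (disjoint_agree cX a) ex.
  exists 0, (Basic c), t, Skip, t'; split=> //;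
    [exact: Ghost_refl|exact: T_basic|].
  move=> x nX; case: (pselect (mod_bcmd c x)) => mx; first exact: am.
  by rewrite -(bexec_mod ex) // a // an.
Qed.

Lemma tabort_erase K C0 s h D : tabort K C0 s h D ->
  forall C t, erase X C = C0 -> auxiliary X C -> agree (~` X) s t ->
  tabort K C t h D.
Proof.
elim=> {K C0 s h D}.
- move=> K r C0 s h D Kr [] // => [c|r' C] t; first by case: c => //= x e;
    case: ifP.
  by move=> /= [-> _] _ _; exact: TA_res_clash.
- move=> K r B C0 s h D Kr [] // => [c|r' B' C] t; first by case: c => //= x e;
    case: ifP.
  by move=> /= [-> _ _] _ _; exact: TA_with.
- move=> K r C0 s h D _ IH [] // => [c|r' C] t; first by case: c => //= x e;
    case: ifP.
  move=> /= [-> e] aux a; apply: TA_res; have := IH _ _ e aux a.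
  by rewrite /open_res -e locked_erase.
- move=> K c s h D ab C t /erase_basic e aux a; have [-> cX] := e aux.
  exact/TA_basic/(babort_agree (disjoint_agree cX a)).
- move=> K C10 C20 s h D _ IH [] // => [c|C1 C2] t; first by case: c => //= x e;
    case: ifP.
  by move=> /= [e1 _] [aux1 _] a; apply/TA_seq/IH.
- move=> K r C0 s h D _ IH [] // => [c|r' C] t; first by case: c => //= x e;
    case: ifP.
  by move=> /= [-> e] aux a; apply/TA_within/IH.
- move=> K C10 C20 s h D _ IH [] // => [c|C1 C2] t; first by case: c => //= x e;
    case: ifP.
  by move=> /= [e1 _] [aux1 _] a; apply/TA_par1/IH.
- move=> K C10 C20 s h D _ IH [] // => [c|C1 C2] t; first by case: c => //= x e;
    case: ifP.
  by move=> /= [_ e2] [_ aux2] a; apply/TA_par2/IH.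
Qed.

(** Neither [D] nor the whole heap changes, yet safety only promises some new split of that heap,
    hence the new [h1] and [hD1]. *)
Lemma safe_ghost_run k m G A Q C t h D hD hF H C1 t1 :
  ghost_run (res_ctx G) D H k C t C1 t1 -> lock_ok G C ->
  framed G C t h D hD hF H -> safe (k + m) G A C Q t h ->
  exists h1 hD1, [/\ lock_ok G C1, framed G C1 t1 h1 D hD1 hF H
                   & safe m G A C1 Q t1 h1].
Proof.
move=> gr; elim: gr h hD =>
  {C t C1 t1} [C t|{}k C t C1 t1 C2 t2 st e a _ IH] h hD lok fr.
  by exists h, hD.
rewrite addSn => sf; have [|_ _ next] := sf t; first by [].
have [g [h' [hD' [HH' HD' sf']]]] := next _ _ _ _ _ _ _ _ fr st.
have [lok1 _ dis] := framed_step lok fr st.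
by apply: (IH h' hD') sf' => //; case: fr => DK _ _ _; split.
Qed.

(* [3 * n] pays for the at most two assignments to X, erased to [Skip], that the
   original command runs before each of its other steps. *)
Lemma safe_erase n G A Q C s t h :
  is_rctx Val Loc G -> X `&` fv_assn Q = set0 -> X `&` pv_ctx G = set0 ->
  auxiliary X C -> lock_ok G C -> agree (~` X) s t ->
  safe (3 * n) G (A `|` X) C Q t h -> safe n G A (erase X C) Q s h.
Proof.
move=> [_ okG] XQ XG; elim: n C s t h => // n IH C s t h aux lok a sf s1 a1.
rewrite locked_erase in a1 *.
have pvX L : pv_of G L `&` X = set0.
  rewrite -subset0 => x [[E HE [_ Ex]] Xx].
  by have : set0 x; [rewrite -XG; split=> //; exists E|].
(* The original run receives the environment's changes outside [X] and keeps its own values on [X],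
   which belongs to its rely-set. *)
pose t1 : store := fun x => if `[< X x >] then t x else s1 x.
have at1 : agree (~` X) s1 t1 by move=> x nX; rewrite /t1; case: asboolP.
have {}sf : safe (3 * n).+3 G (A `|` X) C Q t1 h.
  rewrite mulnS in sf; apply: safe_env sf => x Hx; rewrite /t1.
  case: asboolP => // nX; rewrite -a //; apply: a1.
  by case: Hx => [[Ax|//]|Hx]; [left|right].
have fr' D hD hF H : framed G (erase X C) s1 h D hD hF H ->
    framed G C t1 h D hD hF H.
  rewrite /framed locked_erase => -[? ? HD ?]; split=> //.
  by apply: avail_agree HD => [E /okG []//|]; exact: disjoint_agree at1.
have QX t2 : agree (~` X) s1 t2 -> sat t2 h Q -> sat s1 h Q.
  move=> a2; apply: sat_agree; apply/agree_sym; apply: disjoint_agree a2.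
  by rewrite setIC.
split=> [e|D hD hF H fr ab|D hD hF H C0' s' H' D' fr st].
(* The original command may be one assignment short of [Skip]. Running it with no available resource
   and empty other heaps forces the final heap to be [h] again. *)
- have [k [t2 [k1 gr]]] := ghost_skip (res_ctx G) set0 h t1 e.
  have fr : framed G C t1 h set0 hempty hempty h.
    split=> //; first by rewrite avail0.
    by exists h; exact: hsumh0.
  have sf1 : safe (k + 1) G (A `|` X) C Q t1 h.
    by apply: safe_le sf; rewrite addn1; exact: leq_trans k1 _.
  have [h1 [hD1 [_ [_ _ HD1 [g Hg HH]] sf']]] := safe_ghost_run gr lok fr sf1.
  have [sk _ _] := sf' t2 (fun _ _ => erefl).
  have [_ a2 _] := ghost_agree gr.
  apply: QX (agree_trans at1 a2) _.
  move: HD1; rewrite avail0 => HD1; rewrite /= in HD1; subst hD1.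
  by rewrite (hsum0E HH) (hsum0E Hg); apply: sk.
- have [_ nab _] := sf t1 (fun _ _ => erefl).
  exact/(nab _ _ _ _ (fr' _ _ _ _ fr))/(tabort_erase ab).
- have {}fr := fr' _ _ _ _ fr.
  have [|k [C1 [t2 [C' [t' [k2 gr st' e' a']]]]]] :=
    tstep_erase st (erefl _) aux _ at1.
    by case: fr => DK dis _ _ q Dq; split; [exact: DK|exact: dis].
  have sf1 : safe (k + (3 * n).+1) G (A `|` X) C Q t1 h.
    by apply: safe_le sf; rewrite addnS ltnS -[(3 * n).+2]add2n leq_add2r.
  have [h1 [hD1 [lok1 fr1 sf']]] := safe_ghost_run gr lok fr sf1.
  have [_ _ next] := sf' t2 (fun _ _ => erefl).
  have [g [h' [hD' [HH' HD' sf2]]]] := next _ _ _ _ _ _ _ _ fr1 st'.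
  have [e1 a2 aux1] := ghost_agree gr.
  have [lok' _ _] := framed_step lok1 fr1 st'.
  split.
    rewrite -(locked_erase C1) e1 locked_erase in g.
    move=> x Hx; have nX : ~ X x 
      by move=> Xx; have : set0 x by rewrite -(pvX (~` locked C)).
    by rewrite at1 // a2 // g // a'.
  exists h', hD'; split=> //.
    by apply: avail_agree HD' => [E /okG []//|]; apply/agree_sym;
      exact: disjoint_agree a'.
  by rewrite -e'; apply: IH sf2 => //; exact/(auxiliary_tstep st')/aux1.
Qed.

End Auxiliary.

(** * Renaming of resources *)

Section Renaming.
Context {Var Res : eqType} {Val : valueType} {Loc : pred nat}.
Notation store := (store Var Val).
Notation heap := (heap Val Loc).
Notation rctx := (rctx Var Res).
Notation cmd := (cmd Var Res).
Implicit Types (s : store) (h : heap) (K D L : set Res) (G : rctx) (C : cmd)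
  (f : Res -> Res).

Fixpoint map_cmd f C : cmd :=
  match C with
  | Skip => Skip
  | Basic c => Basic c
  | Seq C1 C2 => Seq (map_cmd f C1) (map_cmd f C2)
  | If B C1 C2 => If B (map_cmd f C1) (map_cmd f C2)
  | While B C1 => While B (map_cmd f C1)
  | Resource q C1 => Resource (f q) (map_cmd f C1)
  | With q B C1 => With (f q) B (map_cmd f C1)
  | Par C1 C2 => Par (map_cmd f C1) (map_cmd f C2)
  | Within q C1 => Within (f q) (map_cmd f C1)
  end.

Definition map_ctx f G : rctx :=
  [seq REntry (f (rname E)) (rvars E) (rinv E) | E <- G].

(* Agrees with [rename_res r r'] except at r'; since it is a bijection, the
   semantics commutes with it without side conditions. *)
Definition swap (r r' q : Res) : Res :=
  if q == r then r' else if q == r' then r else q.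

Lemma swapK r r' : involutive (swap r r').
Proof.
move=> q; rewrite /swap; case: (eqVneq q r) => [->|qr].
  by rewrite eqxx; case: eqP => [->|].
by case: (eqVneq q r') => [->|qr']; rewrite ?eqxx // (negbTE qr) (negbTE qr').
Qed.

Lemma rename_swap r r' q : q <> r' -> rename_res r r' q = swap r r' q.
Proof. by rewrite /rename_res /swap => /eqP/negbTE ->. Qed.

(** The side condition of [CSL_REN] keeps [r'] out of [C], and [r'] is the only name on which the
    two maps can differ. *)
Lemma rename_cmd_swap r r' C : ~ res_cmd C r' ->
  rename_cmd r r' C = map_cmd (swap r r') C.
Proof.
elim: C => //= [C1 IH1 C2 IH2|B C1 IH1 C2 IH2|B C1 IH|q C1 IH|q B C1 IH
  |C1 IH1 C2 IH2|q C1 IH] n.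
1,2,6: by rewrite IH1 ?IH2 // => H; apply: n; [right|left].
1: by rewrite IH.
all: rewrite IH; last by move=> H; apply: n; right.
all: by rewrite rename_swap // => qr; apply: n; left; rewrite /= qr.
Qed.

Lemma rename_ctx_swap r r' G : ~ res_ctx G r' ->
  rename_ctx r r' G = map_ctx (swap r r') G.
Proof.
rewrite /rename_ctx /map_ctx; elim: G => //= E G IH n; rewrite IH.
  rewrite rename_swap // => Er; apply: n.
  by rewrite /res_ctx /= inE Er eqxx.
by move=> H; apply: n; rewrite /res_ctx /= inE; apply/orP; right.
Qed.

Lemma unextended_rename r r' C : unextended (rename_cmd r r' C) = unextended C.
Proof. by elim: C => //= [C1 -> C2 ->|B C1 -> C2 ->|C1 -> C2 ->]. Qed.

Variable f : Res -> Res.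
Hypothesis fK : involutive f.

Lemma involE q r : f q = r <-> q = f r.
Proof. by split=> [<-|->]; rewrite fK. Qed.

(** Sets of names are transported by preimage, which for an involution is also the image and makes
    membership compute. *)
Lemma preimage_add K r : f @^-1` (K `|` [set r]) = f @^-1` K `|` [set f r].
Proof. by apply/predeqP => q; rewrite /preimage /setU /= involE. Qed.

Lemma preimage_del K r : f @^-1` (K `\` [set r]) = f @^-1` K `\` [set f r].
Proof. by apply/predeqP => q; rewrite /preimage /setD /= involE. Qed.

Lemma locked_map C : locked (map_cmd f C) = f @^-1` locked C.
Proof.
elim: C => //= [r C1 ->|C1 -> C2 -> //|r C1 ->].
- by rewrite preimage_del.
- by rewrite preimage_add.
Qed.

Lemma open_res_map r C D :
  open_res (f r) (map_cmd f C) (f @^-1` D) = f @^-1` open_res r C D.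
Proof.
apply/predeqP => q; rewrite /open_res locked_map /preimage /= fK involE; tauto.
Qed.

Lemma tstep_map K C s h D C' s' h' D' : tstep K C s h D C' s' h' D' ->
  tstep (f @^-1` K) (map_cmd f C) s h (f @^-1` D)
        (map_cmd f C') s' h' (f @^-1` D').
Proof.
elim=> {K C s h D C' s' h' D'} /=.
- by move=> *; exact: T_seq_skip.
- by move=> *; exact: T_seq.
- by move=> *; exact: T_while.
- move=> K B C1 C2 s h D; have :=
    T_if (f @^-1` K) B (map_cmd f C1) (map_cmd f C2)
    s h (f @^-1` D); by case: ifP.
- by move=> *; exact: T_par1.
- by move=> *; exact: T_par2.
- by move=> *; exact: T_par_skip.
- by move=> K r s h D nK; apply: T_res_skip; rewrite /preimage /= fK.
- move=> K r C s h D C' s' h' D' nK _ IH; rewrite preimage_del.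
  apply: T_res; first by rewrite /preimage /= fK.
  by rewrite -preimage_add open_res_map.
- move=> K r B C s h D Dr b; rewrite preimage_del.
  by apply: T_with => //; rewrite /preimage /= fK.
- by move=> K r C s h D C' s' h' D' _; rewrite preimage_del => IH;
    exact: T_within.
- by move=> K r s h D; rewrite preimage_add; exact: T_within_skip.
- by move=> *; exact: T_basic.
Qed.

Lemma tabort_map K C s h D : tabort K C s h D ->
  tabort (f @^-1` K) (map_cmd f C) s h (f @^-1` D).
Proof.
elim=> {K C s h D} /=.
- by move=> K r C s h D Kr; apply: TA_res_clash; rewrite /preimage /= fK.
- by move=> K r B C s h D Kr; apply: TA_with; rewrite /preimage /= fK.
- move=> K r C s h D _; rewrite preimage_add -open_res_map => IH.
  exact: TA_res.
- by move=> *; exact: TA_basic.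
- by move=> *; exact: TA_seq.
- by move=> K r C s h D _; rewrite preimage_del => IH; exact: TA_within.
- by move=> *; exact: TA_par1.
- by move=> *; exact: TA_par2.
Qed.

Lemma res_ctx_map G : res_ctx (map_ctx f G) = f @^-1` res_ctx G.
Proof.
apply/predeqP => q; rewrite /res_ctx /map_ctx /preimage /= -map_comp.
elim: G => //= E G; rewrite !inE => IH.
have -> : (f q == rname E) = (q == f (rname E)).
  by apply/eqP/eqP => /involE.
by case: (q == _) => //=.
Qed.

Lemma pv_of_map G L : pv_of (map_ctx f G) (f @^-1` L) = pv_of G L.
Proof.
apply/predeqP => x; elim: G => [|E G IH]; first by split=> -[].
split=> [[E' [<-|HE] [/= lE Ex]]|[E' [<-|HE] [/= lE Ex]]].
- by exists E; [left|split=> //; move: lE; rewrite /preimage /= fK].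
- have : pv_of G L x by apply/IH; exists E'.
  by case=> E2 HE2 H2; exists E2 => //; right.
- exists (REntry (f (rname E)) (rvars E) (rinv E)); first by left.
  by split=> //; rewrite /preimage /= fK.
- have : pv_of (map_ctx f G) (f @^-1` L) x by apply/IH; exists E'.
  by case=> E2 HE2 H2; exists E2 => //; right.
Qed.

Lemma avail_map G D : avail (map_ctx f G) (f @^-1` D) = avail G D.
Proof.
rewrite /avail; elim: G => //= E G IH; rewrite /preimage /= fK.
by case: ifP => //= _; rewrite IH.
Qed.

(** Each environment and each step of [C] is carried by [f] to one of the renamed command, so safety
    can be pulled back. *)
Lemma safe_map n G A C Q s h :
  safe n (map_ctx f G) A (map_cmd f C) Q s h -> safe n G A C Q s h.
Proof.
elim: n C s h => // n IH C s h sf s1 a.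
have [|sk nab st] := sf s1; first by rewrite locked_map pv_of_map.
have fr' D hD hF H : framed G C s1 h D hD hF H ->
    framed (map_ctx f G) (map_cmd f C) s1 h (f @^-1` D) hD hF H.
  move=> [DK dis HD HH]; split=> //; last by rewrite avail_map.
    by rewrite res_ctx_map => q /DK.
  by move=> q /dis; rewrite locked_map.
split=> [E|D hD hF H /fr' fr ab|D hD hF H C' s' H' D' /fr' fr T].
- by apply: sk; rewrite E.
- by apply: nab fr _; rewrite res_ctx_map; exact: tabort_map.
- have := tstep_map T; rewrite -res_ctx_map => /(st _ _ _ _ _ _ _ _ fr).
  move=> [g [h' [hD' [HH' HD' sf']]]]; split.
    by move: g; rewrite locked_map preimage_setC pv_of_map.
  by exists h', hD'; split=> //; [rewrite avail_map in HD'|exact: IH].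
Qed.

End Renaming.

(** * Soundness *)

Section Soundness.
Context {Var Res : eqType} {Val : valueType} {Loc : pred nat}.
Notation store := (store Var Val).
Notation heap := (heap Val Loc).
Notation rctx := (rctx Var Res).
Notation cmd := (cmd Var Res).
Implicit Types (s : store) (h : heap) (D : set Res) (G : rctx) (C : cmd)
  (A X : set Var) (P Q R : assn Var).

Lemma csl_wf G A P C Q : csl Val Loc G A P C Q -> wf_spec Val Loc G A P C Q.
Proof. by case. Qed.

Lemma csl_unextended G A P C Q : csl Val Loc G A P C Q -> unextended C.
Proof.
elim=> {G A P C Q} //=.
- by move=> G A1 A2 P1 P2 P3 C1 C2 _ _ -> _ ->.
- by move=> G A1 A2 P B C1 C2 Q _ _ -> _ ->.
- by move=> G A X P C Q _ _; rewrite unextended_erase.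
- by move=> G A P C Q r r' _ _; rewrite unextended_rename.
- by move=> G A1 A2 P1 P2 C1 C2 Q1 Q2 _ _ -> _ ->.
Qed.

Lemma lock_ok_unextended G C : unextended C -> lock_ok G C.
Proof.
by move=> u; split; [exact: unextended_wf|move=> q /(unextended_locked u)].
Qed.

Lemma csl_safe G A P C Q : csl Val Loc G A P C Q ->
  forall n s h, sat s h P -> safe n G A C Q s h.
Proof.
elim=> {G A P C Q}.
- move=> G A P [_ + _] n s h HP; rewrite subUset => -[PA _].
  exact: safe_skip.
- move=> G A P c Q [okG + _] tr md n s h HP; rewrite subUset => -[PA QA].
  exact: safe_basic HP.
- move=> G A1 A2 P1 P2 P3 C1 C2 wf d1 IH1 d2 IH2 n s h HP.
  apply: safe_seq (IH1 n _ _ HP); first exact: csl_unextended d2.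
  by move=> m t k _; exact: IH2.
- move=> G A P C Q R wf d IH md n s h /satE_star [h1 [h2 [Hh HP HR]]].
  by apply: safe_frame Hh md HR _; exact: IH.
- move=> G A P B C wf d IH n s h HP; have [_ + _] := csl_wf d.
  rewrite !subUset /= => -[[PA BA] _].
  by apply: safe_while => //; exact: csl_unextended d.
- move=> G A1 A2 P1 P2 C Q1 Q2 [okG _ _] _ IH1 _ IH2 n s h [H1 H2].
  by apply: safe_conj => //; [exact: IH1|exact: IH2].
- move=> G A1 A2 P B C1 C2 Q [_ + _] _ IH1 _ IH2 n s h HP.
  rewrite subUset => -[PA _]; apply: (safe_if (P := P)) => // m t k _.
    exact: IH1.
  exact: IH2.
- move=> G A A' P P' C Q Q' _ _ IH PP QQ AA n s h /PP HP.
  by apply: safe_conseq AA QQ _; exact: IH.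
- move=> G A X P C Q [okG _ _] d IH XPQ XG aux n s h HP.
  (* Original and erased command start from the same store, and the induction hypothesis is taken at
     index [3 * n]. *)
  apply: (safe_erase okG _ XG aux _ (fun _ _ => erefl) (IH _ _ _ HP)).
    by rewrite -subset0 -XPQ => x [Xx Qx]; split=> //; right.
  exact/lock_ok_unextended/csl_unextended/d.
- move=> G A P C Q r r' _ _ IH nC nG n s h HP.
  apply: (safe_map (swapK r r')).
  by rewrite -rename_ctx_swap // -rename_cmd_swap //; exact: IH.
- move=> G A1 A2 P1 P2 C1 C2 Q1 Q2 wf d1 IH1 d2 IH2 md1 md2 n s h.
  move=> /satE_star [h1 [h2 [Hh H1 H2]]].
  (* The bounds of [Q1] by [A1] and of [Q2] by [A2] come from the premises; the conclusion bounds
     both only by the union. *)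
  have [_ + _] := csl_wf d1; have [_ + _] := csl_wf d2.
  rewrite !subUset => -[_ QA2] [_ QA1].
  apply: safe_par Hh (IH1 _ _ _ H1) (IH2 _ _ _ H2) => //.
  by apply: lock_ok_unextended;
    rewrite /= (csl_unextended d1) (csl_unextended d2).
- move=> G1 G2 A X P B C Q R r [okG + _] d IH n s h HP.
  rewrite subUset => -[PA QA].
  by apply: (safe_with okG) HP => //; exact: csl_unextended d.
- move=> G1 G2 A X P C Q R r wf d IH n s h.
  move=> /satE_star [h1 [h2 [Hh HP HR]]].
  have [okG + _] := csl_wf d; rewrite subUset => -[PA QA].
  have u := csl_unextended d; have nl := @unextended_locked _ _ C r u.
  apply: (safe_resource okG QA _ (IH n _ _ HP)) => //.
    exact: lock_ok_unextended.
  by exists h2.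
Qed.

(** A closed run is one with an idle environment: its heap is [hempty] and the store is left alone
    between steps. The index is [k.+1] because after [k] steps one more unit is needed to read off
    the postcondition. *)
Lemma safe_pstepn k G A C Q s h hD H (rho : @rconf Res) c' :
  pstepn k (Run C (s, H, rho)) c' -> lock_ok G C -> names rho = res_ctx G ->
  locked C `<=` rO rho -> framed G C s h (rD rho) hD hempty H ->
  safe k.+1 G A C Q s h ->
  match c' with
  | Abort => False
  | Run C' (s', H', rho') =>
      C' = Skip -> rD rho' = res_ctx G -> sat s' H' (AStar Q (inv_ctx G))
  end.
Proof.
elim: k C s h hD H rho => [|k IH] C s h hD H rho /=.
  move=> <- lok _ _ [_ _ HD [g Hg HH]] /(_ s (fun _ _ => erefl)) [sk _ _] E.
  move: HD => /[swap] ->; rewrite avail_all => HD.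
  apply/satE_star; exists h, hD; split=> //; last exact: sk.
  by rewrite (hsum0E HH).
move=> [c1 st pn] lok nE lO fr /(_ s (fun _ _ => erefl)) [_ nab next].
have [w lK] := lok; have := pstep_tstep st w lO.
case: c1 st pn => [C1 [[s1 H1] rho1]|] st pn; rewrite /= nE.
  move=> [T nE1 oE]; have [g [h' [hD' [HH' HD' sf']]]] :=
    next _ _ _ _ _ _ _ _ fr T.
  have [lok' _ dis] := framed_step lok fr T.
  have DK1 : rD rho1 `<=` res_ctx G.
    by rewrite -nE1 => q Dq; apply/namesE; right; right.
  have fr1 : framed G C1 s1 h' (rD rho1) hD' hempty H1 by [].
  by apply: IH pn lok' nE1 _ fr1 sf' => q lq; apply/oE; left.
by move=> /(nab _ _ _ _ fr).
Qed.

End Soundness.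

Theorem theorem2 (Var Res : eqType) (Val : valueType) (Loc : pred nat)
  (G : rctx Var Res) (A : set Var) (P Q : assn Var) (C : cmd Var Res)
  (hG : is_rctx Val Loc G) (hC : unextended C)
  (hder : csl Val Loc G A P C Q) :
  valid Val Loc G P C Q.
Proof.
move=> s h /satE_star [h1 [hD [Hh HP HD]]].
have lok := lock_ok_unextended G hC.
have nE : names (rconf_init (res_ctx G)) = res_ctx G.
  by apply/predeqP => q; rewrite namesE /= /set0 /=; tauto.
have fr : framed G C s h1 (rD (rconf_init (res_ctx G))) hD hempty h.
  split=> //; first by move=> q _; exact: unextended_locked.
    by rewrite /= avail_all.
  by exists h => //; exact: hsumh0.
have lO : locked C `<=` rO (rconf_init (res_ctx G)).
  by move=> q /(unextended_locked hC).
have sf n : safe n G A C Q s h1 by exact: csl_safe hder _ _ _ HP.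
split=> [k pn|k s' h' pn]; first exact: safe_pstepn pn lok nE lO fr (sf _).
exact: (safe_pstepn pn lok nE lO fr (sf _)).
Qed.
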